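(* Let $H$ be a finite-dimensional Hopf algebra over a field $k$, let $\mathcal C={}_H\mathfrak M$, let $L$ be an exact left $H$-comodule algebra with Frobenius system $(\lambda_L,\{a^i\},\{b_i\})$, and let $$\mathfrak T=\sum_i\langle\lambda_L,b_{i(0)}\rangle S^3(b_{i(-1)})g_H\otimes\langle\alpha_H,a^i_{(-1)}\rangle a^i_{(0)}\in H\otimes L.$$ If the Frobenius form $\lambda_L$ is a $g_L$-cointegral for some grouplike element $g_L\in H$, then $$\mathfrak T=g_L^{-1}g_H\otimes1_L.$$ Thus, for $X\in\mathcal C$ and $M\in{}_L\mathfrak M$, the twisted module structure of the relative Serre functor $\mathbb S$ of ${}_L\mathfrak M$ takes the form $$\mathbb S(X\triangleright M)\to X^{**}\triangleright\mathbb S(M),\qquad x\otimes m\mapsto\Phi_X(g_L^{-1}g_Hx)\otimes m,$$ where $\Phi_X:X\to X^{**}$ is the canonical isomorphism of vector spaces.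
   Context: Notation: $H$ has comultiplication $\Delta(h)=h_{(1)}\otimes h_{(2)}$, counit $\varepsilon$, antipode $S$. ${}_A\mathfrak M$ is the category of finite-dimensional left $A$-modules. In the finite tensor category $\mathcal C={}_H\mathfrak M$ the left dual $X^*$ is the dual space with $(hf)(x)=f(S(h)x)$, the right dual ${}^*X$ is the dual space with $(hf)(x)=f(S^{-1}(h)x)$. A left $H$-comodule algebra is an algebra $L$ with a left $H$-comodule structure $\delta_L(a)=a_{(-1)}\otimes a_{(0)}$ that is an algebra map. If $L$ is finite-dimensional, $\mathcal C$ acts on ${}_L\mathfrak M$ by $X\triangleright M=X\otimes M$ with $a(x\otimes m)=a_{(-1)}x\otimes a_{(0)}m$. $L$ is exact if it is finite-dimensional and $P\triangleright M$ is projective for all projective $P\in\mathcal C$ and all $M\in{}_L\mathfrak M$; then $L$ is a Frobenius algebra. A Frobenius system of $L$: a linear form $\lambda_L:L\to k$ (Frobenius form) and bases $\{a^i\},\{b_i\}$ of $L$ with $\langle\lambda_L,a^ib_j\rangle=\delta_{ij}$. For a grouplike $g\in H$, a linear form $\lambda:L\to k$ is a $g$-cointegral on $L$ if $a_{(-1)}\langle\lambda,a_{(0)}\rangle=\langle\lambda,a\rangle g$ for all $a\in L$. The Nakayama automorphism $\nu_L$ is defined by $\langle\lambda_L,ba\rangle=\langle\lambda_L,\nu_L(a)b\rangle$, and $\nu'_L(a)=\langle\alpha_H,\nu_L(a)_{(-1)}\rangle\nu_L(a)_{(0)}$. Integrals: $\Lambda_H\in H$ is a fixed non-zero right integral ($\Lambda_Hh=\varepsilon(h)\Lambda_H$).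 $\alpha_H:H\to k$ is the algebra map with $h\Lambda_H=\langle\alpha_H,h\rangle\Lambda_H$. $\lambda_H\in H^*$ is the right cointegral ($\langle\lambda_H,h_{(1)}\rangle h_{(2)}=\langle\lambda_H,h\rangle1$) with $\langle\lambda_H,\Lambda_H\rangle=1$. $g_H\in H$ is the grouplike element with $h_{(1)}\langle\lambda_H,h_{(2)}\rangle=\langle\lambda_H,h\rangle g_H$ for $h\in H$. Internal Hom functor of ${}_L\mathfrak M$: $[M,N]=\mathrm{Hom}_L(H\triangleright M,N)$ with $H$-action $(h\cdot\xi)(h'\otimes m)=\xi(h'h\otimes m)$; composition $\underline{\mathrm{comp}}:[M_2,M_3]\otimes[M_1,M_2]\to[M_1,M_3]$, $f\otimes g\mapsto[h\otimes m\mapsto f(h_{(1)}\otimes g(h_{(2)}\otimes m))]$; bimodule structure $\mathfrak a_{X,M,N}:X\otimes[M,N]\to[M,X\triangleright N]$, $x\otimes\xi\mapsto[h\otimes m\mapsto h_{(1)}x\otimes\xi(h_{(2)}\otimes m)]$ and $\mathfrak b_{M,N,Y}:[M,N]\otimes Y\to[{}^*Y\triangleright M,N]$, $\xi\otimes y\mapsto[h\otimes y'\otimes m\mapsto\xi(h_{(1)}\otimes m)\langle y',h_{(2)}y\rangle]$. The relative Serre functor $\mathbb S$: $\mathbb S(M)$ is the vector space $M$ with $L$-action $a\bullet m=\nu'_L(a)m$, together with the natural isomorphism $\phi_{M,N}:[N,\mathbb S(M)]\to[M,N]^*$ induced by the pairing $\underline{\mathrm{tr}}_M\circ\underline{\mathrm{comp}}_{M,N,\mathbb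 S(M)}$, where $\underline{\mathrm{tr}}_M(\xi)=\sum_i\langle\lambda_L,t^i(\Lambda_H\otimes\xi(t_i))\rangle$ for any finite family $t_i\in H\triangleright M$, $t^i\in\mathrm{Hom}_L(H\triangleright M,L)$ with $\sum_it^i(x)t_i=x$ for all $x\in H\triangleright M$. Its twisted module structure $\xi_{X,M}:X^{**}\triangleright\mathbb S(M)\to\mathbb S(X\triangleright M)$ is the unique natural isomorphism with $\phi_{X\triangleright M,N}\circ[N,\xi_{X,M}]\circ\mathfrak a_{X^{**},N,\mathbb S(M)}=(\mathfrak b_{M,N,X^*}^{-1})^*\circ(\mathrm{id}_{X^{**}}\otimes\phi_{M,N})$ (with $X^{**}\otimes[M,N]^*=([M,N]\otimes X^* )^*$). In general its inverse $\mathbb S(X\triangleright M)\to X^{**}\triangleright\mathbb S(M)$ is $x\otimes m\mapsto\Phi_X(\mathfrak T_Hx)\otimes\mathfrak T_Lm$, where $\mathfrak T=\mathfrak T_H\otimes\mathfrak T_L$ symbolically; the claim concerns this map. *)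

(* Defs.v *)
From HB Require Import structures.
From mathcomp Require Import all_boot all_algebra all_field.
From mathcomp Require Import boolp classical_sets.

Set Implicit Arguments.
Unset Strict Implicit.
Unset Printing Implicit Defensive.

Import GRing.Theory.
Local Open Scope ring_scope.

Reserved Notation "v ⊗ w" (at level 38, left associativity).
Reserved Notation "X ▷ M" (at level 39, left associativity).
Reserved Notation "\tsum_ ( a , b <- t ) E"
  (at level 37, E at level 40, a name, b name,
   format "\tsum_ ( a ,  b  <-  t )  E").

(** * Tensor products of finite-dimensional vector spaces *)

(* The tensor product is modelled on coordinate matrices: [v ⊗ w] is the matrix
   of products of the coordinates of [v] and [w] in the library's bases of the
   full spaces.  For bilinear [F], [tlift^~ F] is the induced linear map. *)
Section Tensor.
Variable k : fieldType.
Implicit Types V W U : vectType k.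

Definition tbase V : (\dim {:V}).-tuple V := vbasis {:V}.

Definition tensor V W : vectType k := 'M[k]_(\dim {:V}, \dim {:W}).

Definition tens V W (v : V) (w : W) : tensor V W :=
  \matrix_(i, j) (coord (tbase V) i v * coord (tbase W) j w).

Definition tlift V W (U : lmodType k) (t : tensor V W) (F : V -> W -> U) : U :=
  \sum_i \sum_j (t : 'M_(_, _)) i j *: F (tbase V)`_i (tbase W)`_j.

End Tensor.

Arguments tlift {k V W U} t F.

Notation "v ⊗ w" := (tens v w) : ring_scope.

(* Sweedler-style sums: with [t = \sum_i a_i ⊗ b_i] and [E] bilinear in [a, b],
   [\tsum_(a, b <- t) E] is [\sum_i E(a_i, b_i)]. *)
Notation "\tsum_ ( a , b <- t ) E" := (tlift t (fun a b => E)) : ring_scope.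

Section TensorTheory.
Variable k : fieldType.
Implicit Types V W : vectType k.

Lemma lin_lfunE V W (f : V -> W) : linear f -> linfun f =1 f.
Proof.
move=> lf; pose h : {linear V -> W} :=
  HB.pack f (GRing.isLinear.Build k V W _ f lf).
exact: (lfunE h).
Qed.

Lemma tlift_is_linear V W (U : lmodType k) (F : V -> W -> U) :
  linear (tlift^~ F).
Proof.
move=> c s t; rewrite /tlift scaler_sumr -big_split /=; apply: eq_bigr => i _.
rewrite scaler_sumr -big_split /=; apply: eq_bigr => j _.
by rewrite !mxE scalerDl scalerA.
Qed.

Lemma eq_tlift V W (U : lmodType k) (F G : V -> W -> U) (t : tensor V W) :
  (forall v w, F v w = G v w) -> tlift t F = tlift t G.
Proof. by move=> eqFG; do 2!apply: eq_bigr => ? _; rewrite eqFG. Qed.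

Lemma tlift_lin V W (U : lmodType k) c (F G : V -> W -> U) t :
  \tsum_(a, b <- t) (c *: F a b + G a b) =
    c *: (\tsum_(a, b <- t) F a b) + \tsum_(a, b <- t) G a b.
Proof.
rewrite /tlift scaler_sumr -big_split /=; apply: eq_bigr => i _.
rewrite scaler_sumr -big_split /=; apply: eq_bigr => j _.
by rewrite scalerDr !scalerA mulrC.
Qed.

Lemma linear_tlift V W (U U' : lmodType k) (f : U -> U') (F : V -> W -> U) t :
  linear f -> f (\tsum_(a, b <- t) F a b) = \tsum_(a, b <- t) f (F a b).
Proof.
move=> lf; pose h : {linear U -> U'} :=
  HB.pack f (GRing.isLinear.Build k U U' _ f lf).
rewrite -[f]/(h : _ -> _) /tlift linear_sum; apply: eq_bigr => i _.
by rewrite linear_sum; apply: eq_bigr => j _; rewrite linearZ.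
Qed.

Lemma linear_tlift_arg V W (X U : lmodType k) (t : tensor V W)
    (F : X -> V -> W -> U) :
  (forall a b, linear (fun x => F x a b)) ->
  linear (fun x => \tsum_(a, b <- t) F x a b).
Proof.
by move=> lF c x y; rewrite -tlift_lin; apply: eq_tlift => *; rewrite lF.
Qed.

Lemma exchange_tlift V W V' W' (U : lmodType k)
    (s : tensor V W) (t : tensor V' W') (F : V -> W -> V' -> W' -> U) :
  \tsum_(a, b <- s) \tsum_(c, d <- t) F a b c d =
  \tsum_(c, d <- t) \tsum_(a, b <- s) F a b c d.
Proof.
rewrite /tlift !pair_big /=.
under eq_bigr do rewrite pair_big scaler_sumr.
under [RHS]eq_bigr do rewrite pair_big scaler_sumr.
rewrite exchange_big; apply: eq_bigr => p _; apply: eq_bigr => q _.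
by rewrite !scalerA mulrC.
Qed.

Lemma tbaseE V (v : V) : v = \sum_i coord (tbase V) i v *: (tbase V)`_i.
Proof. exact/coord_vbasis/memvf. Qed.

Lemma tlift_tens V W (U : lmodType k) (F : V -> W -> U) v w :
    (forall v, linear (F v)) -> (forall w, linear (F^~ w)) ->
  \tsum_(a, b <- v ⊗ w) F a b = F v w.
Proof.
move=> Fr Fl; pose Fl' b : {linear V -> U} :=
  HB.pack (F^~ b) (GRing.isLinear.Build k V U _ _ (Fl b)).
pose Fr' a : {linear W -> U} :=
  HB.pack (F a) (GRing.isLinear.Build k W U _ _ (Fr a)).
transitivity (Fl' w v) => //; rewrite {2}[v]tbaseE linear_sum /tlift.
apply: eq_bigr => i _; rewrite linearZ /=.
rewrite -[F _ w]/(Fr' (tbase V)`_i w) {2}[w]tbaseE linear_sum scaler_sumr.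
apply: eq_bigr => j _; rewrite linearZ scalerA /=; congr (_ *: _).
by rewrite mxE.
Qed.

Lemma tens_linl V W (w : W) : linear (fun v : V => v ⊗ w).
Proof.
by move=> c u v; apply/matrixP=> i j; rewrite !mxE linearP mulrDl mulrA.
Qed.

Lemma tens_linr V W (v : V) : linear (fun w : W => v ⊗ w).
Proof.
by move=> c u w; apply/matrixP=> i j; rewrite !mxE linearP mulrDr mulrCA.
Qed.

Lemma tlift_id V W (t : tensor V W) : \tsum_(a, b <- t) a ⊗ b = t.
Proof.
rewrite /tlift [RHS]matrix_sum_delta; apply: eq_bigr => i _.
apply: eq_bigr => j _; congr (_ *: _).
apply/matrixP=> i' j'; rewrite !mxE !coord_free ?(basis_free (vbasisP _)) //.
by rewrite -natrM mulnb ![_ == i']eq_sym ![_ == j']eq_sym.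
Qed.

End TensorTheory.

Section TensorMap.
Variable k : fieldType.
Variables V W V' W' : vectType k.

Definition tmap (f : 'Hom(V, V')) (g : 'Hom(W, W')) :
    'Hom(tensor V W, tensor V' W') :=
  linfun (fun t => \tsum_(v, w <- t) f v ⊗ g w).

Lemma tmapE f g t : tmap f g t = \tsum_(v, w <- t) f v ⊗ g w.
Proof.
by rewrite lin_lfunE //; apply: tlift_is_linear.
Qed.

Lemma tmap_tens f g v w : tmap f g (v ⊗ w) = f v ⊗ g w.
Proof.
by rewrite tmapE tlift_tens // => [u c x y|u c x y]; rewrite linearP
  ?tens_linl ?tens_linr.
Qed.

Lemma tmap_linl g : linear (tmap^~ g).
Proof.
move=> c f f'; apply/lfunP=> t; rewrite add_lfunE scale_lfunE !tmapE -tlift_lin.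
by apply: eq_tlift => v w; rewrite add_lfunE scale_lfunE tens_linl.
Qed.

Lemma tmap_linr f : linear (tmap f).
Proof.
move=> c g g'; apply/lfunP=> t; rewrite add_lfunE scale_lfunE !tmapE -tlift_lin.
by apply: eq_tlift => v w; rewrite add_lfunE scale_lfunE tens_linr.
Qed.

End TensorMap.

Lemma tmap_comp (k : fieldType) (V W V' W' V2 W2 : vectType k)
    (f : 'Hom(V', V2)) (g : 'Hom(W', W2))
    (f' : 'Hom(V, V')) (g' : 'Hom(W, W')) :
  tmap (f \o f')%VF (g \o g')%VF = (tmap f g \o tmap f' g')%VF.
Proof.
apply/lfunP=> t; rewrite comp_lfunE [tmap f' g' t]tmapE linear_tlift.
  by rewrite tmapE; apply: eq_tlift => v w; rewrite tmap_tens !comp_lfunE.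
by move=> c x y; rewrite linearP.
Qed.

(** * Hopf algebras and comodule algebras *)

Definition tmul (k : fieldType) (A B : falgType k) (s t : tensor A B) :
    tensor A B :=
  \tsum_(a, b <- s) \tsum_(a', b' <- t) ((a * a') ⊗ (b * b')).

Record hopfAlg (k : fieldType) := HopfAlg {
  hopf_alg :> falgType k;
  comul : 'Hom(hopf_alg, tensor hopf_alg hopf_alg);
  counit : 'Hom(hopf_alg, k^o);
  antipode : 'End(hopf_alg);
  comulA : forall h,
    \tsum_(h1, h2 <- comul h) \tsum_(h11, h12 <- comul h1) h11 ⊗ (h12 ⊗ h2) =
    \tsum_(h1, h2 <- comul h) h1 ⊗ comul h2;
  counitl : forall h, \tsum_(h1, h2 <- comul h) counit h1 *: h2 = h;
  counitr : forall h, \tsum_(h1, h2 <- comul h) counit h2 *: h1 = h;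
  comul1 : comul 1 = 1 ⊗ 1;
  comulM : forall g h, comul (g * h) = tmul (comul g) (comul h);
  counit1 : counit 1 = 1;
  counitM : forall g h, counit (g * h) = counit g * counit h;
  antipodel : forall h,
    \tsum_(h1, h2 <- comul h) antipode h1 * h2 = counit h *: 1;
  antipoder : forall h,
    \tsum_(h1, h2 <- comul h) h1 * antipode h2 = counit h *: 1
}.

Arguments comul {k H} : rename.
Arguments counit {k H} : rename.
Arguments antipode {k H} : rename.

Section HopfTheory.
Variables (k : fieldType) (H : hopfAlg k).

Lemma tsum_comulA (U : lmodType k) (T : H -> H -> H -> U) h :
    (forall b c, linear (fun a => T a b c)) ->
    (forall a c, linear (fun b => T a b c)) ->
    (forall a b, linear (fun c => T a b c)) ->
  \tsum_(h1, h2 <- comul h) \tsum_(h11, h12 <- comul h1) T h11 h12 h2 =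
  \tsum_(h1, h2 <- comul h) \tsum_(h21, h22 <- comul h2) T h1 h21 h22.
Proof.
move=> T1 T2 T3.
pose G (t : tensor H (tensor H H)) : U :=
  \tsum_(a, u <- t) \tsum_(b, c <- u) T a b c.
have lG : linear G by apply: tlift_is_linear.
have lGa a : linear (fun u => \tsum_(b, c <- u) T a b c).
  exact: tlift_is_linear.
have Gt a u : G (a ⊗ u) = \tsum_(b, c <- u) T a b c.
  rewrite /G tlift_tens // => v c x y; rewrite -tlift_lin.
  by apply: eq_tlift => *; rewrite T1.
have := congr1 G (comulA h); rewrite !(linear_tlift _ _ lG).
move=> E; transitivity (\tsum_(h1, h2 <- comul h) G (h1 ⊗ comul h2)).
  rewrite -E; apply: eq_tlift => a b; rewrite (linear_tlift _ _ lG).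
  by apply: eq_tlift => x y; rewrite Gt tlift_tens.
by apply: eq_tlift => a b; rewrite Gt.
Qed.

Lemma antipode1 : antipode (1 : H) = 1.
Proof.
have := antipodel (1 : H); rewrite comul1 counit1 scale1r tlift_tens ?mulr1 //.
  by move=> v c x y; rewrite mulrDr scalerAr.
by move=> v c x y; rewrite linearP mulrDl scalerAl.
Qed.

Lemma antipodeM (x y : H) : antipode (x * y) = antipode y * antipode x.
Proof.
pose F x1 y1 a c d b : H :=
  antipode (x1 * y1) * (a * (c * antipode d) * antipode b).
transitivity (\tsum_(x1, x2 <- comul x) \tsum_(a, b <- comul x2)
  \tsum_(y1, y2 <- comul y) \tsum_(c, d <- comul y2) F x1 y1 a c d b).
  rewrite -{1}(counitr x) (linear_tlift
    (f := fun u => antipode (u * y))); last first.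
    by move=> c u v; rewrite mulrDl -scalerAl linearP.
  apply: eq_tlift => x1 x2.
  transitivity (\tsum_(a, b <- comul x2)
    (antipode (x1 * y) * (a * antipode b))).
    rewrite -(linear_tlift
      (f := fun u => antipode (x1 * y) * u)) ?antipoder; last first.
      by move=> c u v; rewrite mulrDr -scalerAr.
    by rewrite -scalerAr mulr1 -scalerAl linearZ.
  apply: eq_tlift => a b.
  rewrite -{1}(counitr y) (linear_tlift
    (f := fun u => antipode (x1 * u) * (a * antipode b))); last first.
    by move=> c u v; rewrite mulrDr -scalerAr linearP mulrDl -scalerAl.
  apply: eq_tlift => y1 y2; rewrite /F -(linear_tlift
    (f := fun u => antipode (x1 * y1) * (a * u * antipode b))); last first.
    by move=> c u v; rewrite mulrDr mulrDl mulrDr -!(scalerAr, scalerAl).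
  by rewrite antipoder -!scalerAr linearZ mulr1 -!scalerAl -scalerAr.
pose K x1 x2 y1 y2 := \tsum_(a, b <- comul x1) \tsum_(c, d <- comul y1)
  F a c b d y2 x2.
transitivity
  (\tsum_(x1, x2 <- comul x) \tsum_(y1, y2 <- comul y) K x1 x2 y1 y2).
  pose T x1 a b := \tsum_(y1, y2 <- comul y) \tsum_(c, d <- comul y2)
    F x1 y1 a c d b.
  rewrite -(tsum_comulA (T := T)); last 3 first.
  - move=> b c; do 2!apply: linear_tlift_arg => ? ?; move=> z u v.
    by rewrite /F mulrDl -scalerAl linearP mulrDl -scalerAl.
  - move=> b c; do 2!apply: linear_tlift_arg => ? ?; move=> z u v.
    by rewrite /F !mulrDl mulrDr -!(scalerAl, scalerAr).
  - move=> b c; do 2!apply: linear_tlift_arg => ? ?; move=> z u v.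
    by rewrite /F linearP !mulrDr -!scalerAr.
  apply: eq_tlift => x1 x2; rewrite [RHS]exchange_tlift.
  apply: eq_tlift => a b; rewrite /T.
  rewrite -(tsum_comulA (T := fun y1 c d => F a y1 b c d x2)) //
    => [d e|d e|d e] z u v; rewrite /F.
  - by rewrite mulrDr -scalerAr linearP mulrDl -scalerAl.
  - by rewrite !(mulrDl, mulrDr) -!(scalerAl, scalerAr).
  - by rewrite linearP !(mulrDl, mulrDr) -!(scalerAl, scalerAr).
have KE x1 x2 y1 y2 :
    K x1 x2 y1 y2 = counit x1 *: (counit y1 *: (antipode y2 * antipode x2)).
  pose m u := u * (antipode y2 * antipode x2) : H.
  have lm : linear m by move=> c u v; rewrite /m mulrDl -scalerAl.
  pose p (t : tensor H H) : H := \tsum_(u, v <- t) antipode u * v.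
  have lp : linear p by apply: tlift_is_linear.
  have pE u v : p (u ⊗ v) = antipode u * v.
    apply: tlift_tens => w c z z'; first by rewrite mulrDr -scalerAr.
    by rewrite linearP mulrDl -scalerAl.
  transitivity (m (p (comul (x1 * y1)))); last first.
    by rewrite /p antipodel counitM /m -scalerAl mul1r scalerA.
  rewrite comulM /tmul !(linear_tlift _ _ lp) !(linear_tlift _ _ lm).
  apply: eq_tlift => a b; rewrite !(linear_tlift _ _ lp) !(linear_tlift _ _ lm).
  by apply: eq_tlift => c d; rewrite pE /m /F !mulrA.
rewrite -{2}(counitl x) (linear_tlift
    (f := fun u => antipode y * antipode u)); last first.
  by move=> c u v; rewrite linearP mulrDr -scalerAr.
apply: eq_tlift => x1 x2; rewrite -{2}(counitl y) (linear_tlift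
    (f := fun u => antipode u * antipode (counit x1 *: x2))); last first.
  by move=> c u v; rewrite linearP mulrDl -scalerAl.
by apply: eq_tlift => y1 y2; rewrite KE !linearZ /= -scalerAl -scalerAr.
Qed.

End HopfTheory.

Record comodAlg (k : fieldType) (H : hopfAlg k) := ComodAlg {
  comod_alg :> falgType k;
  coact : 'Hom(comod_alg, tensor H comod_alg);
  coactA : forall a,
    \tsum_(a1, a0 <- coact a) \tsum_(a11, a12 <- comul a1) a11 ⊗ (a12 ⊗ a0) =
    \tsum_(a1, a0 <- coact a) a1 ⊗ coact a0;
  coact_counit : forall a, \tsum_(a1, a0 <- coact a) counit a1 *: a0 = a;
  coact1 : coact 1 = 1 ⊗ 1;
  coactM : forall a b, coact (a * b) = tmul (coact a) (coact b)
}.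

Arguments coact {k H L} : rename.

(** * Representations *)

Section Rep.
Variables (k : fieldType) (A : falgType k).

Record rep := Rep {
  rep_space :> vectType k;
  rep_act : 'Hom(A, 'End(rep_space));
  rep_act1 : rep_act 1 = \1%VF;
  rep_actM : forall a b, rep_act (a * b) = (rep_act a \o rep_act b)%VF
}.

Definition is_hom (M N : rep) (f : 'Hom(M, N)) : Prop :=
  forall a m, f (rep_act M a m) = rep_act N a (f m).

Definition surjective (V W : vectType k) (f : 'Hom(V, W)) : Prop :=
  forall w, exists v, f v = w.

Definition projective (P : rep) : Prop :=
  forall (M N : rep) (p : 'Hom(M, N)) (f : 'Hom(P, N)),
    is_hom p -> surjective p -> is_hom f ->
  exists2 g : 'Hom(P, M), is_hom g & forall x, p (g x) = f x.

Definition reg_act : 'Hom(A, 'End(A)) := linfun (@amull k A).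

Lemma reg_act1 : reg_act 1 = \1%VF.
Proof.
by apply/lfunP=> x; rewrite /reg_act lfunE /= lfunE /= id_lfunE mul1r.
Qed.

Lemma reg_actM a b : reg_act (a * b) = (reg_act a \o reg_act b)%VF.
Proof.
by apply/lfunP=> x; rewrite comp_lfunE; do 6!rewrite ?lfunE /=; rewrite mulrA.
Qed.

Definition regular_rep : rep := Rep reg_act1 reg_actM.

End Rep.

Section TensorRep.
Variables (k : fieldType) (H : hopfAlg k) (L : comodAlg H).
Variables (X : rep H) (M : rep L).

Definition tens_act : 'Hom(L, 'End(tensor X M)) :=
  linfun (fun a =>
    \tsum_(a1, a0 <- coact a) tmap (rep_act X a1) (rep_act M a0)).

Let Q (t : tensor H L) : 'End(tensor X M) :=
  \tsum_(a1, a0 <- t) tmap (rep_act X a1) (rep_act M a0).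

Let linQ : linear Q. Proof. exact: tlift_is_linear. Qed.

Let Qtens a b : Q (a ⊗ b) = tmap (rep_act X a) (rep_act M b).
Proof.
by apply: tlift_tens => u c x y; rewrite linearP ?tmap_linl ?tmap_linr.
Qed.

Lemma tens_actE a :
  tens_act a = \tsum_(a1, a0 <- coact a) tmap (rep_act X a1) (rep_act M a0).
Proof. by rewrite lin_lfunE // => c x y; rewrite linearP tlift_is_linear. Qed.

Lemma tens_act1 : tens_act 1 = \1%VF.
Proof.
rewrite tens_actE coact1 -/(Q _) Qtens !rep_act1; apply/lfunP=> t.
rewrite tmapE id_lfunE -[RHS]tlift_id.
by apply: eq_tlift => *; rewrite !id_lfunE.
Qed.

Lemma tens_actM a b : tens_act (a * b) = (tens_act a \o tens_act b)%VF.
Proof.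
rewrite !tens_actE coactM -!/(Q _) /tmul (linear_tlift _ _ linQ).
rewrite {2}/Q (linear_tlift (f := fun f => (f \o Q (coact b))%VF)); last first.
  by move=> c f g; rewrite comp_lfunDl comp_lfunZl.
apply: eq_tlift => a1 a0; rewrite (linear_tlift _ _ linQ).
rewrite (linear_tlift
  (f := fun f => (tmap (rep_act X a1) (rep_act M a0) \o f)%VF)).
  by apply: eq_tlift => b1 b0; rewrite Qtens !rep_actM tmap_comp.
by move=> c f g; rewrite comp_lfunDr comp_lfunZr.
Qed.

Definition tens_rep : rep L := Rep tens_act1 tens_actM.

End TensorRep.

Notation "X ▷ M" := (tens_rep X M) : ring_scope.

Definition exact_comodAlg (k : fieldType) (H : hopfAlg k) (L : comodAlg H) :
    Prop :=
  forall (P : rep H) (M : rep L), projective P -> projective (P ▷ M).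

(** * Duals *)

Definition dual_space (k : fieldType) (V : vectType k) : vectType k :=
  'Hom(V, k^o).

Definition dual_map (k : fieldType) (V W : vectType k) (f : 'Hom(V, W)) :
    'Hom(dual_space W, dual_space V) :=
  linfun (fun p : 'Hom(W, k^o) => (p \o f)%VF).

(* The canonical map from a space to its double dual. *)
Definition bidual (k : fieldType) (V : vectType k) :
    'Hom(V, dual_space (dual_space V)) :=
  linfun (fun v => linfun (fun p : dual_space V => (p : 'Hom(V, k^o)) v)).

Section Duals.
Variables (k : fieldType) (H : hopfAlg k).

Definition dual_act (s : 'End(H)) (X : rep H) :
    'Hom(H, 'End(dual_space X)) :=
  linfun (fun h => dual_map (rep_act X (s h))).

Section AntiMorphism.
Variables (s : 'End(H)) (X : rep H).
Hypothesis s1 : s 1 = 1.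
Hypothesis sM : forall x y, s (x * y) = s y * s x.

Lemma dual_mapE (V W : vectType k) (f : 'Hom(V, W)) (p : 'Hom(W, k^o)) :
  dual_map f p = (p \o f)%VF.
Proof. by rewrite lin_lfunE // => c u v; rewrite comp_lfunDl comp_lfunZl. Qed.

Lemma dual_actE h : dual_act s X h = dual_map (rep_act X (s h)).
Proof.
rewrite lin_lfunE // => c u v; apply/lfunP=> p.
by rewrite add_lfunE scale_lfunE !dual_mapE !linearP comp_lfunDr comp_lfunZr.
Qed.

Lemma dual_act1 : dual_act s X 1 = \1%VF.
Proof.
apply/lfunP=> p.
by rewrite dual_actE s1 rep_act1 dual_mapE comp_lfun1r id_lfunE.
Qed.

Lemma dual_actM g h :
  dual_act s X (g * h) = (dual_act s X g \o dual_act s X h)%VF.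
Proof.
apply/lfunP=> p; rewrite comp_lfunE !dual_actE sM rep_actM !dual_mapE.
by rewrite comp_lfunA.
Qed.

End AntiMorphism.

Definition ldual (X : rep H) : rep H :=
  Rep (dual_act1 X (@antipode1 k H)) (dual_actM X (@antipodeM k H)).

(* The antipode of a finite-dimensional Hopf algebra is bijective, so the [else]
   branch is never taken; it makes the definition total, in the same way as
   inverses of non-units are set by convention. *)
Definition antipode_inv : 'End(H) :=
  let S : 'End(H) := antipode in if lker S == 0%VS then (S^-1)%VF else S.

Lemma antipode_inv1 : antipode_inv 1 = 1.
Proof.
rewrite /antipode_inv; case: ifP => [inj_S|_]; last exact: antipode1.
by rewrite -{1}(@antipode1 k H) lker0_lfunK.
Qed.

Lemma antipode_invM x y :
  antipode_inv (x * y) = antipode_inv y * antipode_inv x.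
Proof.
rewrite /antipode_inv; case: ifP => [inj_S|_]; last exact: antipodeM.
apply: (lker0P inj_S); rewrite antipodeM !lker0_lfunVK //.
Qed.

Definition rdual (X : rep H) : rep H :=
  Rep (dual_act1 X antipode_inv1) (dual_actM X antipode_invM).

End Duals.

(** * Integrals and Frobenius systems *)

Definition grouplike (k : fieldType) (H : hopfAlg k) (g : H) : Prop :=
  comul g = g ⊗ g /\ counit g = 1.

(* [int_elt], [int_form], [int_alpha] and [int_g] are the right integral, the
   right cointegral, the modular function and the distinguished grouplike
   element, usually written Lambda_H, lambda_H, alpha_H and g_H. *)
Record integralData (k : fieldType) (H : hopfAlg k) := IntegralData {
  int_elt : H;
  int_alpha : 'Hom(H, k^o);
  int_form : 'Hom(H, k^o);
  int_g : H;
  int_elt_neq0 : int_elt != 0;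
  int_eltr : forall h, int_elt * h = counit h *: int_elt;
  int_alpha1 : int_alpha 1 = 1;
  int_alphaM : forall g h, int_alpha (g * h) = int_alpha g * int_alpha h;
  int_alphaP : forall h, h * int_elt = int_alpha h *: int_elt;
  int_formr : forall h,
    \tsum_(h1, h2 <- comul h) int_form h1 *: h2 = int_form h *: 1;
  int_formE : int_form int_elt = 1;
  int_g_grouplike : grouplike int_g;
  int_gP : forall h,
    \tsum_(h1, h2 <- comul h) int_form h2 *: h1 =
      int_form h *: int_g
}.

Record frobSystem (k : fieldType) (L : falgType k) := FrobSystem {
  frob_form : 'Hom(L, k^o);
  frob_a : (\dim {:L}).-tuple L;
  frob_b : (\dim {:L}).-tuple L;
  frob_a_basis : basis_of {:L} frob_a;
  frob_b_basis : basis_of {:L} frob_b;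
  frob_dual : forall i j : 'I_(\dim {:L}),
    frob_form (frob_a`_i * frob_b`_j) = (i == j)%:R
}.

Definition is_cointegral (k : fieldType) (H : hopfAlg k) (L : comodAlg H)
    (g : H) (lam : 'Hom(L, k^o)) : Prop :=
  forall a, \tsum_(a1, a0 <- coact a) lam a0 *: a1 = lam a *: g.

Section Nakayama.
Variables (k : fieldType) (L : falgType k) (F : frobSystem L).
Local Notation lam := (frob_form F).

Lemma frob_a_expand x :
  x = \sum_(i < \dim {:L}) lam (x * (frob_b F)`_i) *: (frob_a F)`_i.
Proof.
have /(_ x) xE := coord_basis (frob_a_basis F); rewrite {1}xE ?memvf //.
apply: eq_bigr => i _; congr (_ *: _); rewrite {2}xE ?memvf //.
rewrite mulr_suml linear_sum (bigD1 i) //= -scalerAl linearZ /= frob_dual eqxx.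
rewrite big1 ?addr0 => [|j ji]; first by rewrite /= [_ *: _]mulr1.
by rewrite -scalerAl linearZ /= frob_dual (negPf ji) scaler0.
Qed.

Lemma frob_b_expand x :
  x = \sum_(i < \dim {:L}) lam ((frob_a F)`_i * x) *: (frob_b F)`_i.
Proof.
have /(_ x) xE := coord_basis (frob_b_basis F); rewrite {1}xE ?memvf //.
apply: eq_bigr => i _; congr (_ *: _); rewrite {2}xE ?memvf //.
rewrite mulr_sumr linear_sum (bigD1 i) //= -scalerAr linearZ /= frob_dual eqxx.
rewrite big1 ?addr0 => [|j ji]; first by rewrite /= [_ *: _]mulr1.
by rewrite -scalerAr linearZ /= frob_dual eq_sym (negPf ji) scaler0.
Qed.

Lemma frob_nondeg x y : (forall b, lam (x * b) = lam (y * b)) -> x = y.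
Proof.
move=> xy; rewrite [x]frob_a_expand [y]frob_a_expand.
by apply: eq_bigr => i _; rewrite xy.
Qed.

(* By [nakayamaP] and [frob_nondeg], [nakayama a] is the only element [c] such
   that [lam (b * a) = lam (c * b)] for all [b]. *)
Definition nakayama : 'End(L) :=
  linfun (fun a =>
    \sum_(i < \dim {:L}) lam ((frob_b F)`_i * a) *: (frob_a F)`_i).

Lemma nakayamaP a b : lam (b * a) = lam (nakayama a * b).
Proof.
rewrite lin_lfunE; last first.
  move=> c x y; rewrite scaler_sumr -big_split; apply: eq_bigr => i _ /=.
  by rewrite mulrDr -scalerAr linearP scalerDl scalerA.
rewrite {1}[b]frob_b_expand !mulr_suml !linear_sum; apply: eq_bigr => i _.
by rewrite -!scalerAl !linearZ /= [LHS]mulrC.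
Qed.

Lemma nakayama1 : nakayama 1 = 1.
Proof. by apply: frob_nondeg => b; rewrite -nakayamaP mulr1 mul1r. Qed.

Lemma nakayamaM a b : nakayama (a * b) = nakayama a * nakayama b.
Proof.
apply: frob_nondeg => c.
by rewrite -[RHS](congr1 lam (mulrA _ _ _)) -!nakayamaP -mulrA -nakayamaP mulrA.
Qed.

End Nakayama.

(** * The module category and its internal Hom *)

Section Serre.
Variables (k : fieldType) (H : hopfAlg k) (L : comodAlg H).

Section InternalHom.
Implicit Types (M N : rep L) (X Y : rep H).

(* The internal Hom [M, N] is the space of the maps from [hrep M] to [N] that
   satisfy [is_hom]; [ihom_a] and [ihom_b] are its left and right C-bimodule
   structure maps. *)
Definition hrep M : rep L := regular_rep H ▷ M.

Definition ihom_comp M1 M2 M3 (f : 'Hom(hrep M2, M3)) (g : 'Hom(hrep M1, M2)) :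
    'Hom(hrep M1, M3) :=
  linfun (fun t : tensor H M1 =>
    \tsum_(h, m <- t) \tsum_(h1, h2 <- comul h) f (h1 ⊗ g (h2 ⊗ m))).

Definition ihom_a X M N (x : X) (xi : 'Hom(hrep M, N)) :
    'Hom(hrep M, X ▷ N) :=
  linfun (fun t : tensor H M =>
    \tsum_(h, m <- t) \tsum_(h1, h2 <- comul h) rep_act X h1 x ⊗ xi (h2 ⊗ m)).

Definition ihom_b M N Y (xi : 'Hom(hrep M, N)) (y : Y) :
    'Hom(hrep (rdual Y ▷ M), N) :=
  linfun (fun t : tensor H (tensor (dual_space Y) M) =>
    \tsum_(h, u <- t) \tsum_(y', m <- u) \tsum_(h1, h2 <- comul h)
      (y' : 'Hom(Y, k^o)) (rep_act Y h2 y) *: xi (h1 ⊗ m)).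

End InternalHom.

Variables (I : integralData H) (F : frobSystem L).

Definition nakayama' (a : L) : L :=
  \tsum_(a1, a0 <- coact (nakayama F a)) int_alpha I a1 *: a0.

Lemma nakayama'_lin : linear nakayama'.
Proof. by move=> c x y; rewrite /nakayama' !linearP tlift_is_linear. Qed.

Let R (t : tensor H L) : L := \tsum_(a1, a0 <- t) int_alpha I a1 *: a0.

Let linR : linear R. Proof. exact: tlift_is_linear. Qed.

Let Rtens a b : R (a ⊗ b) = int_alpha I a *: b.
Proof.
apply: tlift_tens => u c x y; first by rewrite scalerDr !scalerA mulrC.
by rewrite linearP scalerDl scalerA.
Qed.

Lemma nakayama'1 : nakayama' 1 = 1.
Proof.
by rewrite /nakayama' nakayama1 coact1 -/(R _) Rtens int_alpha1 scale1r.
Qed.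

Lemma nakayama'M a b : nakayama' (a * b) = nakayama' a * nakayama' b.
Proof.
rewrite /nakayama' nakayamaM coactM -!/(R _) /tmul (linear_tlift _ _ linR).
transitivity (\tsum_(a1, a0 <- coact (nakayama F a))
    (int_alpha I a1 *: a0 * R (coact (nakayama F b)))).
  apply: eq_tlift => a1 a0; rewrite (linear_tlift _ _ linR).
  have lf : linear (fun u => int_alpha I a1 *: a0 * u).
    by move=> c u v; rewrite mulrDr -scalerAr.
  rewrite [RHS](linear_tlift (fun b1 b0 => int_alpha I b1 *: b0) _ lf).
  apply: eq_tlift => b1 b0; rewrite Rtens int_alphaM.
  by rewrite -scalerAl -scalerAr scalerA.
have lf : linear (fun u => u * R (coact (nakayama F b))).
  by move=> c u v; rewrite mulrDl -scalerAl.
by rewrite [RHS](linear_tlift (fun a1 a0 => int_alpha I a1 *: a0) _ lf).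
Qed.

Section SerreObj.
Variable M : rep L.

Definition serre_act : 'Hom(L, 'End(M)) :=
  linfun (fun a => rep_act M (nakayama' a)).

Lemma serre_actE a : serre_act a = rep_act M (nakayama' a).
Proof. by rewrite lin_lfunE // => c x y; rewrite nakayama'_lin linearP. Qed.

Lemma serre_act1 : serre_act 1 = \1%VF.
Proof. by rewrite serre_actE nakayama'1 rep_act1. Qed.

Lemma serre_actM a b : serre_act (a * b) = (serre_act a \o serre_act b)%VF.
Proof. by rewrite !serre_actE nakayama'M rep_actM. Qed.

Definition serre : rep L := Rep serre_act1 serre_actM.

End SerreObj.

Definition dual_family (P : rep L) (n : nat)
    (t : 'I_n -> P) (t' : 'I_n -> 'Hom(P, regular_rep L)) : Prop :=
  (forall i, is_hom (t' i)) /\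
  (forall x, \sum_i rep_act P (t' i x) (t i) = x).

(* For [xi] in [M, S M] and [L] exact, dual families exist and the sum is the
   same for all of them; [serre_trace] is this common value. *)
Definition serre_trace (M : rep L) (xi : 'Hom(hrep M, serre M)) : k :=
  xget 0 [set c | exists n (t : 'I_n -> hrep M)
                           (t' : 'I_n -> 'Hom(hrep M, regular_rep L)),
    dual_family t t' /\
    c = \sum_i frob_form F (t' i (int_elt I ⊗ xi (t i)))]%classic.

Definition serre_pairing (M N : rep L) (zeta : 'Hom(hrep N, serre M))
    (eta : 'Hom(hrep M, N)) : k :=
  serre_trace (ihom_comp zeta eta).

(* A family [xi] is the twisted module structure of the relative Serre functor
   if it is a natural isomorphism in [X] and [M] such that
     phi_(X ▷ M, N) \o [N, xi] \o a = (b^-1)^* \o (id ⊗ phi_(M, N)),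
   where [phi] is the map given by [serre_pairing].  The equation is evaluated
   at [p ⊗ zeta], and then at [b (eta ⊗ f)], with [p] in the double dual of [X],
   [zeta] in [N, S M], [eta] in [M, N] and [f] in the dual of [X].  The target
   [rdual (ldual X) ▷ M, N] of [b] becomes [X ▷ M, N] by composition with
   [bidual X], which identifies [X] with [rdual (ldual X)]. *)
Record is_twisted_structure
    (xi : forall (X : rep H) (M : rep L),
       'Hom(ldual (ldual X) ▷ serre M, serre (X ▷ M))) : Prop := {
  twisted_hom : forall X M, is_hom (xi X M);
  twisted_bij : forall X M, bijective (xi X M);
  twisted_natural : forall (X X' : rep H) (M M' : rep L)
      (f : 'Hom(X, X')) (g : 'Hom(M, M')),
    is_hom f -> is_hom g ->
    (xi X' M' \o tmap (dual_map (dual_map f)) g = tmap f g \o xi X M)%VF;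
  twisted_eq : forall (X : rep H) (M N : rep L)
      (p : ldual (ldual X)) (f : ldual X)
      (zeta : 'Hom(hrep N, serre M)) (eta : 'Hom(hrep M, N)),
    is_hom zeta -> is_hom eta ->
    serre_pairing (xi X M \o ihom_a p zeta)%VF
      (ihom_b eta f \o tmap \1 (tmap (bidual X) \1))%VF =
    (p : 'Hom(dual_space X, k^o)) f * serre_pairing zeta eta
}.

Definition frakT : tensor H L :=
  \sum_(i < \dim {:L})
    (\tsum_(b1, b0 <- coact (frob_b F)`_i)
        frob_form F b0 *: (antipode (antipode (antipode b1)) * int_g I))
    ⊗ (\tsum_(a1, a0 <- coact (frob_a F)`_i) int_alpha I a1 *: a0).

End Serre.

Arguments is_twisted_structure {k H L} I F xi.

(* Main.v *)
Require Import Defs.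
From mathcomp Require Import all_boot all_algebra all_field.
From mathcomp Require Import boolp classical_sets.
Import GRing.Theory.
Local Open Scope ring_scope.

(** The formula for the element T is immediate: the cointegral property turns
    the first factor into [S^3 gL * gH = gL^-1 gH] times [λ_L(b_i)], and
    then [sum_i λ_L(b_i) a^i = 1].

    For the module structure, the idea is to compute the trace that defines the
    Serre pairing as an ordinary trace of a linear endomorphism of [M].  Put
    [A_j = a^j] and [B_j = ν(b_j)], so that [sum_j A_j ⊗ B_j] is the Casimir
    element of [L].  Averaging a linear map [f : H ▷ M -> N] gives an L-linear
    map [sum_j A_j f(B_j -)], and every L-linear map is such an average because
    [H ▷ M] is projective ([higman], [hom_higman]).  The cointegral property
    describes how the coaction moves across the Casimir element
    ([tsum_casimir]); with it, [comp_higman] writes the endomorphism of [H ▷ M]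
    whose twisted trace is the pairing of [zeta] with the average of [f] as an
    average too.  The twisted trace of an average is the ordinary trace of the
    map that is averaged, so the pairing equals
      [Tr_M (m |-> zeta(gL^-1 Λ_1 ⊗ f(Λ_2 ⊗ m)))]      ([pairing_higman]).

    In this form the equation that defines the twisted structure can be checked
    directly: the action of [gH^-1 gL] is the candidate ([serre_twist]), and
    the equation becomes
      [Λ_2 ⊗ Λ_3 ⊗ S(Λ_4) gH^-1 S^2(Λ_1) = Λ_1 ⊗ Λ_2 ⊗ 1]
    ([tsum_int_cancel]), a consequence of the symmetry
      [Λ_2 ⊗ gH^-1 S^2(Λ_1) = Λ_1 ⊗ Λ_2]               ([tsum_int_swap])
    of the integral.  The candidate is L-linear because of Radford's formula
    for [S^4] and the behaviour of the coaction under the Nakayama automorphism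
    ([radford_S4], [tsum_coact_nakayama']).  It is the only solution, since a
    suitable rank-one [f] makes the trace equal to any given coordinate of
    [xi(p ⊗ m)] ([twisted_determined]).

    The Hopf algebra facts are derived from the integral and the cointegral by
    pushing elements through [Λ_1 ⊗ Λ_2].  Identities that would contain
    [S^-1] are stated after applying [S] or [S^2], so that injectivity of [S]
    is enough ([antipode_eq0]). *)

Set Implicit Arguments.
Unset Strict Implicit.
Unset Printing Implicit Defensive.

(** * Linearity side conditions *)

(** Values of linear forms are read in [k] rather than in the regular module
    [k^o], so that scaling by them is scaling over [k]. *)
Reserved Notation "⟨ f , x ⟩" (at level 0, f, x at level 99).

Section Linearity.
Variable k : fieldType.
Implicit Types (U V W : lmodType k) (X Y Z : vectType k).

Lemma fun_linear0 U V (f : U -> V) : linear f -> f 0 = 0.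
Proof.
by move=> lf; have := lf (-1) 0 0; rewrite scaler0 addr0 scaleN1r addNr.
Qed.

Lemma fun_linearZ U V (f : U -> V) c x : linear f -> f (c *: x) = c *: f x.
Proof. by move=> lf; rewrite -[c *: x]addr0 lf fun_linear0 // !addr0. Qed.

Lemma fun_linear_sum U V (f : U -> V) (I : Type) (r : seq I) (P : pred I) F :
  linear f -> f (\sum_(i <- r | P i) F i) = \sum_(i <- r | P i) f (F i).
Proof.
move=> lf; apply: big_morph; last exact: fun_linear0.
by move=> x y; rewrite -[x]scale1r lf !scale1r.
Qed.

Lemma lin_id U : linear (fun x : U => x).
Proof. by []. Qed.

Lemma lin_comp U V W (f : V -> W) (g : U -> V) :
  linear f -> linear g -> linear (fun x => f (g x)).
Proof. by move=> lf lg c x y; rewrite lg lf. Qed.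

Lemma lin_lfun X Y U (f : 'Hom(X, Y)) (g : U -> X) :
  linear g -> linear (fun x => f (g x)).
Proof. by move=> lg c x y; rewrite lg linearP. Qed.

Lemma lin_lfun_fun X Y U (g : U -> 'Hom(X, Y)) v :
  linear g -> linear (fun x => g x v).
Proof. by move=> lg c x y; rewrite lg add_lfunE scale_lfunE. Qed.

Lemma lin_mull (A : falgType k) U (g : U -> A) (b : A) :
  linear g -> linear (fun x => g x * b).
Proof. by move=> lg c x y; rewrite lg mulrDl scalerAl. Qed.

Lemma lin_mulr (A : falgType k) U (g : U -> A) (b : A) :
  linear g -> linear (fun x => b * g x).
Proof. by move=> lg c x y; rewrite lg mulrDr scalerAr. Qed.

Lemma lin_scalel U V (g : U -> k^o) (v : V) :
  linear g -> linear (fun x => (g x : k) *: v).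
Proof. by move=> lg c x y; rewrite lg scalerDl scalerA. Qed.

Lemma lin_scaler U V (g : U -> V) (c : k) :
  linear g -> linear (fun x => c *: g x).
Proof. by move=> lg d x y; rewrite lg scalerDr !scalerA mulrC. Qed.

Lemma lin_tensl U X Y (g : U -> X) (w : Y) :
  linear g -> linear (fun x => g x ⊗ w).
Proof. by move=> lg c x y; rewrite lg tens_linl. Qed.

Lemma tensZl X Y c (v : X) (w : Y) : (c *: v) ⊗ w = c *: (v ⊗ w).
Proof. exact: fun_linearZ (@tens_linl k X Y w). Qed.

Lemma lin_tensr U X Y (g : U -> Y) (v : X) :
  linear g -> linear (fun x => v ⊗ g x).
Proof. by move=> lg c x y; rewrite lg tens_linr. Qed.

Lemma lin_tlift U V X Y (t : tensor X Y) (F : U -> X -> Y -> V) :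
  (forall a b, linear (fun x => F x a b)) ->
  linear (fun x => \tsum_(a, b <- t) F x a b).
Proof. exact: linear_tlift_arg. Qed.

Lemma lin_tlift_fst U V X Y (t : U -> tensor X Y) (F : X -> Y -> V) :
  linear t -> linear (fun x => \tsum_(a, b <- t x) F a b).
Proof. by move=> lt c x y; rewrite lt tlift_is_linear. Qed.

Lemma lin_sum U V (I : Type) (r : seq I) (P : pred I) (F : U -> I -> V) :
  (forall i, linear (fun x => F x i)) ->
  linear (fun x => \sum_(i <- r | P i) F x i).
Proof.
move=> lF c x y; rewrite scaler_sumr -big_split; apply: eq_bigr => i _.
exact: lF.
Qed.

Lemma lin_coord X n (e : n.-tuple X) i : linear (coord e i : X -> k^o).
Proof. by move=> c x y; rewrite linearP. Qed.

Lemma tlift_scale U X Y c (t : tensor X Y) (F : X -> Y -> U) :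
  c *: \tsum_(a, b <- t) F a b = \tsum_(a, b <- t) (c *: F a b).
Proof.
exact: (linear_tlift (f := fun x => c *: x)) (lin_scaler _ (@lin_id _)).
Qed.

Lemma tlift_sum U X Y (I : Type) (r : seq I) (t : tensor X Y)
    (F : I -> X -> Y -> U) :
  \tsum_(a, b <- t) \sum_(i <- r) F i a b =
  \sum_(i <- r) \tsum_(a, b <- t) F i a b.
Proof.
rewrite /tlift [RHS]exchange_big; apply: eq_bigr => p _ /=.
rewrite [RHS]exchange_big; apply: eq_bigr => q _ /=.
by rewrite scaler_sumr.
Qed.
End Linearity.

(** Sweedler manipulations leave goals saying that an expression is linear in
    one of its legs.  [lin] decides them by the shape of the expression, going
    down to the unique occurrence of the leg; a hypothesis on an abstract
    function is used when no rule for a known operation applies. *)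
Ltac lin :=
  cbv beta;
  lazymatch goal with
  | |- forall _, _ => first [ assumption | let x := fresh in intro x; lin]
  | |- _ =>
  solve [ assumption | exact: lin_id
        | apply: lin_tensl; lin | apply: lin_tensr; lin
        | apply: lin_mull; lin | apply: lin_mulr; lin
        | apply: lin_scalel; lin | apply: lin_scaler; lin
        | apply: lin_sum; lin
        | apply: lin_tlift; lin | apply: lin_tlift_fst; lin
        | apply: lin_lfun; lin | apply: lin_lfun_fun; lin
        | match goal with
          | H : _ |- _ => exact: H
          | H : _ |- _ => refine (lin_comp H _); lin
          | H : _ |- _ => refine (lin_comp (H _) _); lin
          | H : _ |- _ => refine (lin_comp (H _ _) _); lin
          | H : _ |- _ => refine (lin_comp (H _ _ _) _); lin
          end ]
  end.

(** * Sweedler calculus in a Hopf algebra *)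

Section Sweedler.
Variables (k : fieldType) (H : hopfAlg k).
Implicit Types (U : lmodType k) (g h : H).
Local Notation S := (@antipode k H).
Local Notation "⟨ f , x ⟩" := (f x : k).

Lemma tsum_comulM U (F : H -> H -> U) g h :
    (forall v, linear (F v)) -> (forall w, linear (F^~ w)) ->
  \tsum_(a, b <- comul (g * h)) F a b =
  \tsum_(g1, g2 <- comul g) \tsum_(h1, h2 <- comul h) F (g1 * h1) (g2 * h2).
Proof.
move=> Fr Fl; have lF : linear (fun t => \tsum_(a, b <- t) F a b).
  exact: tlift_is_linear.
rewrite comulM /tmul (linear_tlift _ _ lF); apply: eq_tlift => g1 g2.
rewrite (linear_tlift _ _ lF); apply: eq_tlift => h1 h2.
by rewrite tlift_tens.
Qed.

Lemma tsum_counitl U (F : H -> U) h : linear F ->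
  \tsum_(a, b <- comul h) ⟨counit, a⟩ *: F b = F h.
Proof.
move=> lF; rewrite -{2}(counitl h) (linear_tlift _ _ lF).
by apply: eq_tlift => a b; rewrite fun_linearZ.
Qed.

Lemma tsum_counitr U (F : H -> U) h : linear F ->
  \tsum_(a, b <- comul h) ⟨counit, b⟩ *: F a = F h.
Proof.
move=> lF; rewrite -{2}(counitr h) (linear_tlift _ _ lF).
by apply: eq_tlift => a b; rewrite fun_linearZ.
Qed.

Lemma tsum_antipodel U (F : H -> U) h : linear F ->
  \tsum_(a, b <- comul h) F (S a * b) = ⟨counit, h⟩ *: F 1.
Proof.
by move=> lF; rewrite -fun_linearZ // -antipodel (linear_tlift _ _ lF).
Qed.

Lemma tsum_antipoder U (F : H -> U) h : linear F ->
  \tsum_(a, b <- comul h) F (a * S b) = ⟨counit, h⟩ *: F 1.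
Proof.
by move=> lF; rewrite -fun_linearZ // -antipoder (linear_tlift _ _ lF).
Qed.

Section Cancel.
Variables (U : lmodType k) (F : H -> H -> U).
Hypotheses (Fr : forall v, linear (F v)) (Fl : forall w, linear (F^~ w)).

(** The four lemmas below are the cancellations [S(h_1) h_2 ⊗ h_3 = 1 ⊗ h] and
    their variants, in right-nested form.  All longer computations bring the
    iterated coproduct to that form by coassociativity first. *)
Lemma tsum_SKl h :
  \tsum_(a, b <- comul h) \tsum_(c, d <- comul b) F (S a * c) d = F 1 h.
Proof.
rewrite -(tsum_comulA (T := fun a c d => F (S a * c) d)) //; try lin.
rewrite -[RHS](tsum_counitl (F := F 1)) //; apply: eq_tlift => a b.
by rewrite (tsum_antipodel (F := F^~ b)).
Qed.

Lemma tsum_KSl h :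
  \tsum_(a, b <- comul h) \tsum_(c, d <- comul b) F (a * S c) d = F 1 h.
Proof.
rewrite -(tsum_comulA (T := fun a c d => F (a * S c) d)) //; try lin.
rewrite -[RHS](tsum_counitl (F := F 1)) //; apply: eq_tlift => a b.
by rewrite (tsum_antipoder (F := F^~ b)).
Qed.

Lemma tsum_SKr h :
  \tsum_(a, b <- comul h) \tsum_(c, d <- comul b) F a (S c * d) = F h 1.
Proof.
rewrite -[RHS](tsum_counitr (F := F^~ 1)) //; apply: eq_tlift => a b.
by rewrite (tsum_antipodel (F := F a)).
Qed.

Lemma tsum_KSr h :
  \tsum_(a, b <- comul h) \tsum_(c, d <- comul b) F a (c * S d) = F h 1.
Proof.
rewrite -[RHS](tsum_counitr (F := F^~ 1)) //; apply: eq_tlift => a b.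
by rewrite (tsum_antipoder (F := F a)).
Qed.

End Cancel.

(** Both sides are convolution inverses of the comultiplication: the sum of
    the [E], where the coproduct of [S h_1] is multiplied by that of [h_2] and
    by [S(h_4) ⊗ S(h_3)], collapses to either side. *)
Lemma tsum_comulS U (F : H -> H -> U) h :
    (forall v, linear (F v)) -> (forall w, linear (F^~ w)) ->
  \tsum_(a, b <- comul (S h)) F a b = \tsum_(a, b <- comul h) F (S b) (S a).
Proof.
move=> Fr Fl.
pose E a p q1 q2 := \tsum_(u, v <- comul (S a)) \tsum_(p1, p2 <- comul p)
  F (u * (p1 * S q2)) (v * (p2 * S q1)).
transitivity (\tsum_(a, b <- comul h) \tsum_(p, q <- comul b)
    \tsum_(q1, q2 <- comul q) E a p q1 q2).
  rewrite -[LHS](tsum_counitr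
    (F := fun a => \tsum_(u, v <- comul (S a)) F u v)); last by lin.
  apply: eq_tlift => a b; rewrite /E.
  pose G x y := \tsum_(u, v <- comul (S a)) F (u * x) (v * y).
  transitivity (\tsum_(p, q <- comul b) \tsum_(p1, p2 <- comul p)
      \tsum_(q1, q2 <- comul q) G (p1 * S q2) (p2 * S q1)); last first.
    apply: eq_tlift => p q; rewrite exchange_tlift; apply: eq_tlift => q1 q2.
    by rewrite exchange_tlift.
  have Gr x : linear (G x) by rewrite /G; lin.
  have Gl x : linear (G^~ x) by rewrite /G; lin.
  rewrite (tsum_comulA (T := fun p1 p2 q => \tsum_(q1, q2 <- comul q)
    G (p1 * S q2) (p2 * S q1))); try lin.
  rewrite -[LHS]/(_ *: _).
  transitivity (\tsum_(p1, r <- comul b) G (p1 * S r) 1).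
    rewrite (tsum_antipoder (F := G^~ 1)) // /G; congr (_ *: _).
    by apply: eq_tlift => u v; rewrite !mulr1.
  apply: eq_tlift => p1 r; rewrite (tsum_KSl (F := fun x y =>
    G (p1 * S y) x)) //; lin.
rewrite -(tsum_comulA (T := fun a p q => \tsum_(q1, q2 <- comul q) E a p q1
  q2));
  rewrite /E; try lin.
rewrite -[RHS](tsum_counitl (F := fun q => \tsum_(a, b <- comul q) F (S b)
  (S a)));
  last by lin.
apply: eq_tlift => c q; rewrite exchange_tlift.
transitivity (\tsum_(q1, q2 <- comul q) \tsum_(a, b <- comul c)
  \tsum_(u, v <- comul (S a * b)) F (u * S q2) (v * S q1)).
  apply: eq_tlift => q1 q2; apply: eq_tlift => a p.
  rewrite tsum_comulM; try lin.
  by do 2!apply: eq_tlift => ? ?; rewrite !mulrA.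
transitivity (\tsum_(q1, q2 <- comul q) (⟨counit, c⟩ *: F (S q2) (S q1)));
   last by rewrite tlift_scale.
apply: eq_tlift => q1 q2.
rewrite (tsum_antipodel (F := fun x => \tsum_(u, v <- comul x) F (u * S q2)
  (v * S q1)));
  last by lin.
by rewrite comul1 tlift_tens ?mul1r //; lin.
Qed.

Section Grouplike.
Variable g : H.
Hypothesis gg : grouplike g.

Lemma grouplike_comul U (F : H -> H -> U) :
    (forall v, linear (F v)) -> (forall w, linear (F^~ w)) ->
  \tsum_(a, b <- comul g) F a b = F g g.
Proof. by move=> Fr Fl; rewrite gg.1 tlift_tens. Qed.

Lemma grouplikeVl : S g * g = 1.
Proof.
have := antipodel g; rewrite grouplike_comul; [|lin..].
by rewrite gg.2 scale1r.
Qed.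

Lemma grouplikeVr : g * S g = 1.
Proof.
have := antipoder g; rewrite grouplike_comul; [|lin..].
by rewrite gg.2 scale1r.
Qed.

Lemma grouplike_unit : g \is a GRing.unit.
Proof. by apply/unitrP; exists (S g); rewrite grouplikeVl grouplikeVr. Qed.

Lemma grouplike_antipode : S g = g^-1.
Proof.
by apply: (mulIr grouplike_unit); rewrite grouplikeVl mulVr ?grouplike_unit.
Qed.

Lemma grouplikeV : grouplike g^-1.
Proof.
rewrite -grouplike_antipode; split.
  rewrite -[LHS]tlift_id tsum_comulS; [|lin..].
  by rewrite grouplike_comul //; lin.
have: counit (1 : H) = 1 by exact: counit1.
by rewrite -grouplikeVl counitM gg.2 mulr1.
Qed.
End Grouplike.

Lemma grouplikeM g h : grouplike g -> grouplike h -> grouplike (g * h).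
Proof.
move=> gg gh; split; last by rewrite counitM gg.2 gh.2 mulr1.
rewrite -[LHS]tlift_id tsum_comulM; [|lin..].
by rewrite !grouplike_comul //; lin.
Qed.

Lemma counit_antipode h : counit (S h) = counit h.
Proof.
transitivity (\tsum_(a, b <- comul h) (⟨counit, b⟩ *: counit (S a))).
  by rewrite (tsum_counitr (F := fun a => counit (S a))) //; lin.
transitivity (counit (⟨counit, h⟩ *: (1 : H))); last first.
  by rewrite linearZ /= counit1; apply: mulr1.
rewrite -antipodel (linear_tlift (f := counit)); last by lin.
by apply: eq_tlift => a b; rewrite counitM mulrC.
Qed.

End Sweedler.

(** * Integrals and cointegrals *)

Section TensorEq.
Variable k : fieldType.
Variables V W : vectType k.
Local Notation "⟨ f , x ⟩" := (f x : k).

(** Contracting with a functional on the first leg suffices, since these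
    contractions contain the matrix entries. *)
Lemma tensor_eq (s t : tensor V W) :
    (forall f : 'Hom(V, k^o), \tsum_(a, b <- s) (⟨f, a⟩ *: b) =
                              \tsum_(a, b <- t) (⟨f, a⟩ *: b)) ->
  s = t.
Proof.
have entry (r : tensor V W) i j : r i j =
    coord (tbase W) j (\tsum_(a, b <- r) (coord (tbase V) i a *: b)).
  pose G (r : tensor V W) : k^o :=
    coord (tbase W) j (\tsum_(a, b <- r) (coord (tbase V) i a *: b)).
  have lG : linear G by move=> c x y; rewrite /G tlift_is_linear linearP.
  rewrite -/(G r) -{2}[r]tlift_id (linear_tlift _ _ lG).
  pose E (r : tensor V W) : k^o := r i j.
  have lE : linear E by move=> c x y; rewrite /E !mxE.
  rewrite -/(E r) -{1}[r]tlift_id (linear_tlift _ _ lE).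
  apply: (@eq_tlift _ _ _ k^o) => v w; rewrite /E /G tlift_tens; last 2 first.
  - by move=> u c x y; rewrite scalerDr !scalerA mulrC.
  - by move=> u c x y; rewrite linearP scalerDl scalerA.
  by rewrite mxE linearZ.
move=> eq_st; apply/matrixP=> i j; rewrite !entry; congr (coord _ _ _).
have lc := @lin_coord _ _ _ (tbase V) i.
have := eq_st (linfun (coord (tbase V) i : V -> k^o)).
under eq_tlift do rewrite (lin_lfunE lc).
by move=> ->; under eq_tlift do rewrite (lin_lfunE lc).
Qed.
End TensorEq.

Section Integrals.
Variables (k : fieldType) (H : hopfAlg k) (I : integralData H).
Implicit Types (U : lmodType k) (g h : H).
Local Notation S := (@antipode k H).
Local Notation Λ := (int_elt I).
Local Notation λ := (int_form I).
Local Notation α := (int_alpha I).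
Local Notation gH := (int_g I).
Local Notation "⟨ f , x ⟩" := (f x : k).

Lemma int_alphaMl U (F : U) (x y : H) :
  ⟨α, x⟩ *: (⟨α, y⟩ *: F) = ⟨α, x * y⟩ *: F.
Proof. by rewrite int_alphaM scalerA. Qed.

Lemma tsum_int_form U (F : H -> U) h : linear F ->
  \tsum_(a, b <- comul h) ⟨λ, a⟩ *: F b = ⟨λ, h⟩ *: F 1.
Proof.
move=> lF; rewrite -fun_linearZ // -int_formr (linear_tlift _ _ lF).
by apply: eq_tlift => a b; rewrite fun_linearZ.
Qed.

Lemma tsum_int_g U (F : H -> U) h : linear F ->
  \tsum_(a, b <- comul h) ⟨λ, b⟩ *: F a = ⟨λ, h⟩ *: F gH.
Proof.
move=> lF; rewrite -fun_linearZ // -int_gP (linear_tlift _ _ lF).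
by apply: eq_tlift => a b; rewrite fun_linearZ.
Qed.

Lemma int_form_eltM h : ⟨λ, Λ * h⟩ = counit h.
Proof. by rewrite int_eltr linearZ /= int_formE; apply: mulr1. Qed.

Lemma int_form_Melt h : ⟨λ, h * Λ⟩ = α h.
Proof. by rewrite int_alphaP linearZ /= int_formE; apply: mulr1. Qed.

(** Invariance of the cointegral moves [y] from one leg to the other,
    [λ(h_1 y) h_2 = λ(h y_1) S(y_2)]; at [h = Λ] only the counit is left. *)
Lemma tsum_int_fst U (F : H -> U) y : linear F ->
  \tsum_(a, b <- comul Λ) ⟨λ, a * y⟩ *: F b = F (S y).
Proof.
move=> lF; rewrite -[RHS](tsum_counitl (F := fun y => F (S y))); last by lin.
transitivity (\tsum_(y1, y2 <- comul y) (⟨λ, Λ * y1⟩ *: F (S y2))); last first.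
  by apply: eq_tlift => a b; rewrite int_form_eltM.
transitivity (\tsum_(y1, y2 <- comul y) \tsum_(y11, y12 <- comul y1)
  \tsum_(a, b <- comul Λ) (⟨λ, a * y11⟩ *: F (b * (y12 * S y2)))); last first.
  apply: eq_tlift => y1 y2; rewrite exchange_tlift.
  rewrite -[in RHS](mul1r (S y2)) -(tsum_int_form (F := fun x => F (x * S y2)));
    last by lin.
  rewrite tsum_comulM; [|lin..]; do 2!apply: eq_tlift => ? ?; by rewrite mulrA.
rewrite (tsum_comulA (T := fun y1 y2 y3 => \tsum_(a, b <- comul Λ)
  (⟨λ, a * y1⟩ *: F (b * (y2 * S y3))))); try lin.
rewrite (tsum_KSr (F := fun x y => \tsum_(a, b <- comul Λ)
  (⟨λ, a * x⟩ *: F (b * y)))); [|lin..].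
by apply: eq_tlift => a b; rewrite mulr1.
Qed.

(** Insert [S(h_1) h_2] in front of the first leg, and read
    [h_2 Λ_1 ⊗ h_3 Λ_2] as the coproduct of a multiple of [Λ]. *)
Lemma tsum_int_mulr U (F : H -> H -> U) h :
    (forall v, linear (F v)) -> (forall w, linear (F^~ w)) ->
  \tsum_(a, b <- comul Λ) F a (h * b) =
  \tsum_(h1, h2 <- comul h) \tsum_(a, b <- comul Λ) ⟨α, h2⟩ *: F (S h1 * a) b.
Proof.
move=> Fr Fl.
transitivity (\tsum_(h1, r <- comul h) \tsum_(h2, h3 <- comul r)
  \tsum_(a, b <- comul Λ) F (S h1 * h2 * a) (h3 * b)).
  rewrite (tsum_SKl (F := fun x y => \tsum_(a, b <- comul Λ) F (x * a)
    (y * b)));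
    [|lin..].
  by apply: eq_tlift => a b; rewrite mul1r.
apply: eq_tlift => h1 h2.
transitivity (\tsum_(a, b <- comul (h2 * Λ)) F (S h1 * a) b).
  by rewrite tsum_comulM; [do 2!apply: eq_tlift => ? ?; rewrite mulrA|lin..].
rewrite int_alphaP -tlift_scale.
by rewrite (fun_linearZ (f := fun x => \tsum_(a, b <- comul x) F
  (S h1 * a) b)); last lin.
Qed.

(** This is the identity [λ(S(w) h_1) h_2 = λ(S(w_2) h) w_1] at [h = Λ].  It
    shows that [S w] determines [w], as the right-hand side is [w] up to a
    convolution with the invertible character [α]. *)
Lemma tsum_int_antipode U (F : H -> U) w : linear F ->
  \tsum_(a, b <- comul Λ) ⟨λ, S w * a⟩ *: F b =
  \tsum_(w1, w2 <- comul w) ⟨α, S w2⟩ *: F w1.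
Proof.
move=> lF.
transitivity (\tsum_(w1, w2 <- comul w) (⟨λ, S w2 * Λ⟩ *: F w1)); last first.
  by apply: eq_tlift => *; rewrite int_form_Melt.
transitivity (\tsum_(w1, r <- comul w) \tsum_(w2, w3 <- comul r)
  \tsum_(a, b <- comul Λ) (⟨λ, S w3 * a⟩ *: F (w1 * S w2 * b))).
  rewrite (tsum_KSl (F := fun x y =>
    \tsum_(a, b <- comul Λ) ⟨λ, S y * a⟩ *: F (x * b))); [|lin..].
  by apply: eq_tlift => a b; rewrite mul1r.
apply: eq_tlift => w1 w2; rewrite -[w1 in RHS]mulr1.
rewrite -(tsum_int_form (F := fun x => F (w1 * x))); last by lin.
rewrite tsum_comulM; [|lin..]; rewrite tsum_comulS; [|lin..].
by do 2!apply: eq_tlift => ? ?; rewrite mulrA.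
Qed.

Lemma antipode_eq0 w : S w = 0 -> w = 0.
Proof.
move=> Sw0.
pose F u := \tsum_(a, b <- comul u) ⟨α, b⟩ *: a.
have lF : linear F by rewrite /F; lin.
have := tsum_int_antipode w lF; rewrite Sw0.
rewrite (eq_tlift (G := fun _ _ => 0)); last first.
  by move=> a b; rewrite mul0r linear0 scale0r.
rewrite {1}/tlift big1 => [E|i _]; last by rewrite big1 // => j _;
  rewrite scaler0.
transitivity (⟨α, 1⟩ *: w); first by rewrite int_alpha1 scale1r.
rewrite -(tsum_KSr (F := fun x y => ⟨α, y⟩ *: x)); [|lin..].
rewrite E -(tsum_comulA (T := fun a c d => ⟨α, c * S d⟩ *: a)); try lin.
apply: eq_tlift => a b; rewrite /F tlift_scale; apply: eq_tlift => c d.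
by rewrite int_alphaMl int_alphaM mulrC -int_alphaM.
Qed.

(** The companion of [tsum_int_fst] for the other leg, where the cointegral is
    only invariant up to [gH]. *)
Lemma tsum_int_snd U (F : H -> U) w : linear F ->
  \tsum_(a, b <- comul Λ) ⟨λ, b * S w⟩ *: F a = F (gH * w).
Proof.
move=> lF; rewrite -[RHS](tsum_counitl (F := fun y => F (gH * y))); last by lin.
transitivity (\tsum_(w1, w2 <- comul w) (⟨λ, Λ * S w1⟩ *: F (gH * w2)));
  last first.
  by apply: eq_tlift => a b; rewrite int_form_eltM counit_antipode.
transitivity (\tsum_(w1, r <- comul w) \tsum_(w2, w3 <- comul r)
  \tsum_(a, b <- comul Λ) (⟨λ, b * S w1⟩ *: F (a * (S w2 * w3)))).
  rewrite (tsum_SKr (F := fun x y => \tsum_(a, b <- comul Λ)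
    (⟨λ, b * S x⟩ *: F (a * y)))); [|lin..].
  by apply: eq_tlift => a b; rewrite mulr1.
rewrite -(tsum_comulA (T := fun y1 y2 y3 => \tsum_(a, b <- comul Λ)
  (⟨λ, b * S y1⟩ *: F (a * (S y2 * y3))))); try lin.
apply: eq_tlift => w1 w2; rewrite exchange_tlift.
rewrite -(tsum_int_g (F := fun x => F (x * w2))); last by lin.
rewrite tsum_comulM; [|lin..]; apply: eq_tlift => a b.
rewrite tsum_comulS; [|lin..].
by apply: eq_tlift => ? ?; rewrite mulrA.
Qed.

(** The pairing [λ(x y)] is nondegenerate: by [tsum_int_fst] the functional
    [λ(- S w)] determines [S (S w)], and [S] is injective. *)
Lemma int_form_span (f : 'Hom(H, k^o)) :
  exists w, forall x, ⟨f, x⟩ = λ (x * S w).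
Proof.
pose G w : 'Hom(H, k^o) := linfun (fun x => λ (x * S w)).
have GE w x : G w x = λ (x * S w) by rewrite lin_lfunE //; lin.
have lG : linear G.
  move=> c u v; apply/lfunP => x; rewrite add_lfunE scale_lfunE !GE.
  by rewrite !linearP mulrDr -scalerAr linearP.
have injG : lker (linfun G) == 0%VS.
  rewrite -subv0; apply/subvP=> w; rewrite memv_ker memv0 lin_lfunE // =>
    /eqP Gw.
  suff: S w = 0 by move/antipode_eq0->.
  apply: antipode_eq0; rewrite -(tsum_int_fst (F := id)) //.
  rewrite (eq_tlift (G := fun _ _ => 0)); last first.
    by move=> a b; rewrite -GE Gw lfunE scale0r.
  by rewrite /tlift big1 // => i _; rewrite big1 // => j _; rewrite scaler0.
have: f \in limg (linfun G).
  suff ->: limg (linfun G) = fullv by rewrite memvf.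
  apply/eqP; rewrite eqEdim subvf limg_dim_eq; last by rewrite (eqP injG) capv0.
  by rewrite !dimvf /dim /= muln1.
case/memv_imgP=> w _ ->; exists w => x.
by rewrite (lin_lfunE lG) GE.
Qed.

(** The Nakayama-type symmetry of the integral.  Contracted with [λ(- S w)],
    both sides give [S (S w)], by [tsum_int_snd] and [tsum_int_fst]; these
    functionals are all there are. *)
Lemma tsum_int_swap U (F : H -> H -> U) :
    (forall v, linear (F v)) -> (forall w, linear (F^~ w)) ->
  \tsum_(a, b <- comul Λ) F b (gH^-1 * S (S a)) = \tsum_(a, b <- comul Λ) F a b.
Proof.
move=> Fr Fl; have gg := int_g_grouplike I.
suff E : \tsum_(a, b <- comul Λ) (b ⊗ (gH^-1 * S (S a))) = comul Λ.
  rewrite -[in RHS]E (linear_tlift (f := fun t => \tsum_(a, b <- t) F a b));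
    last by lin.
  by apply: eq_tlift => a b; rewrite tlift_tens.
apply: tensor_eq => f; have [w fE] := int_form_span f.
transitivity (S (S w)); last first.
  rewrite -(tsum_int_fst (F := id)) //.
  by apply: eq_tlift => a b; rewrite fE.
rewrite (linear_tlift (f := fun t => \tsum_(a, b <- t) (⟨f, a⟩ *: b)));
  last by lin.
transitivity (gH^-1 * S (S (gH * w))).
  rewrite -(tsum_int_snd (F := fun a => gH^-1 * S (S a))); last by lin.
  by apply: eq_tlift => a b; rewrite tlift_tens; [rewrite fE|lin..].
rewrite !antipodeM mulrA (grouplike_antipode gg).
by rewrite (grouplike_antipode (grouplikeV gg)) invrK mulVr ?mul1r //
  grouplike_unit.
Qed.

(** After [tsum_int_swap], the legs that were first and last become neighbours
    and cancel. *)
Lemma tsum_int_cancel U (G : H -> H -> H -> U) :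
    (forall v w, linear (fun u => G u v w)) ->
    (forall u w, linear (fun v => G u v w)) ->
    (forall u v, linear (G u v)) ->
  \tsum_(a, b <- comul Λ) \tsum_(a1, a2 <- comul a) \tsum_(b1, b2 <- comul b)
    G a2 b1 (S b2 * (gH^-1 * S (S a1))) =
  \tsum_(a, b <- comul Λ) G a b 1.
Proof.
move=> G1 G2 G3.
pose Z r w := \tsum_(u, b <- comul r) \tsum_(b1, b2 <- comul b) G u b1
  (S b2 * w).
rewrite (tsum_comulA (T := fun a1 u b => \tsum_(b1, b2 <- comul b)
  G u b1 (S b2 * (gH^-1 * S (S a1))))); [|lin..].
rewrite (tsum_int_swap (F := Z)); try by rewrite /Z; lin.
transitivity (\tsum_(p, r <- comul Λ) \tsum_(q, b <- comul r)
  \tsum_(q1, q2 <- comul q) G p q1 (S q2 * b)).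
  by rewrite -(tsum_comulA (T := fun p q b => \tsum_(q1, q2 <- comul q)
    G p q1 (S q2 * b))); [|lin..].
apply: eq_tlift => p r.
rewrite (tsum_comulA (T := fun q1 q2 b => G p q1 (S q2 * b))); [|lin..].
by rewrite (tsum_SKr (F := G p)).
Qed.

(** Radford's formula, [α(h_1) h_2 = gH^-1 S^4(h_1) gH α(h_2)]: multiplying the
    second leg of [Λ_1 ⊗ Λ_2] by [h] can be moved to the first leg
    ([tsum_int_mulr]), and [tsum_int_swap] exchanges the legs.  Going round
    once returns [h] to its place, having applied [S^4], a conjugation by [gH]
    and [α] on both sides. *)
Lemma radford_S4 h :
  \tsum_(a, b <- comul h) (⟨α, a⟩ *: b) =
  \tsum_(a, b <- comul h) (⟨α, b⟩ *: (gH^-1 * S (S (S (S a))) * gH)).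
Proof.
have gg := int_g_grouplike I.
pose ad x := gH^-1 * S (S (S (S x))) * gH.
have lad : linear ad by rewrite /ad; lin.
(* The formula in two-sided form, [x = α(S x_1) α(x_3) ad x_2]; cancelling
   [α(h_1) α(S h_2)] gives the lemma. *)
have key x : x = \tsum_(a, b <- comul x) \tsum_(p, q <- comul a)
    (⟨α, b⟩ *: (⟨α, S p⟩ *: ad q)).
  pose F (a b : H) : H := ⟨λ, a⟩ *: b.
  have Fr v : linear (F v) by rewrite /F; lin.
  have Fl v : linear (F^~ v) by rewrite /F; lin.
  have FE z : \tsum_(a, b <- comul Λ) F a (z * b) = z.
    rewrite /F (tsum_int_form (F := fun b => z * b)); last by lin.
    by rewrite int_formE mulr1 scale1r.
  rewrite -[LHS]FE tsum_int_mulr //; apply: eq_tlift => a b.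
  rewrite -!tlift_scale; congr (_ *: _).
  rewrite -(tsum_int_swap (F := fun u v => F (S a * u) v)); [|lin..].
  rewrite (tsum_int_mulr (F := fun u v => F v (gH^-1 * S (S u)))); [|lin..].
  rewrite tsum_comulS; [|lin..]; apply: eq_tlift => p q.
  rewrite -tlift_scale; congr (_ *: _).
  rewrite -[RHS]FE -(tsum_int_swap (F := fun a b => F a (ad q * b))); [|lin..].
  apply: eq_tlift => u v; congr F; rewrite /ad !antipodeM -!mulrA;
    do 2!congr (_ * _).
  by rewrite mulVKr // grouplike_unit.
transitivity (\tsum_(a, x <- comul h) \tsum_(u, b <- comul x)
  \tsum_(p, q <- comul u) (⟨α, a⟩ *: (⟨α, b⟩ *: (⟨α, S p⟩ *: ad q)))).
  apply: eq_tlift => a x; rewrite {1}[x]key tlift_scale.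
  by apply: eq_tlift => u b; rewrite tlift_scale.
rewrite -(tsum_comulA (T := fun a u b => \tsum_(p, q <- comul u)
  (⟨α, a⟩ *: (⟨α, b⟩ *: (⟨α, S p⟩ *: ad q))))); try lin.
apply: eq_tlift => x b; rewrite -/(ad x).
transitivity (⟨α, b⟩ *: (⟨α, 1⟩ *: ad x)); last by rewrite int_alpha1 scale1r.
rewrite -(tsum_KSl (F := fun u v => ⟨α, u⟩ *: ad v)); [|lin..].
rewrite !tlift_scale; apply: eq_tlift => a u.
rewrite !tlift_scale; apply: eq_tlift => p q.
by rewrite -int_alphaMl !scalerA mulrCA mulrA.
Qed.

Lemma grouplike_int_g_comm g : grouplike g -> g * gH = gH * g.
Proof.
move=> gg; have ug := int_g_grouplike I.
have := radford_S4 g; rewrite !grouplike_comul; [|lin..].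
have gV := grouplikeV gg.
rewrite !(grouplike_antipode gg, grouplike_antipode gV, invrK) => E.
have: ⟨α, g^-1⟩ *: (⟨α, g⟩ *: g) = ⟨α, g^-1⟩ *: (⟨α, g⟩ *: (gH^-1 * g * gH)).
  by rewrite E.
rewrite !int_alphaMl mulVr ?grouplike_unit // int_alpha1 !scale1r => {2}->.
by rewrite !mulrA divrr ?mul1r // grouplike_unit.
Qed.

End Integrals.

(** * Comodule algebras with a cointegral as Frobenius form *)

Section Coaction.
Variables (k : fieldType) (H : hopfAlg k) (L : comodAlg H).
Implicit Types (U : lmodType k) (g h : H).
Local Notation S := (@antipode k H).
Local Notation "⟨ f , x ⟩" := (f x : k).

Lemma tsum_coactA U (T : H -> H -> L -> U) a :
    (forall b c, linear (fun a => T a b c)) ->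
    (forall a c, linear (fun b => T a b c)) ->
    (forall a b, linear (fun c => T a b c)) ->
  \tsum_(a1, a0 <- coact a) \tsum_(x, y <- comul a1) T x y a0 =
  \tsum_(a1, a0 <- coact a) \tsum_(b1, b0 <- coact a0) T a1 b1 b0.
Proof.
move=> T1 T2 T3.
pose G (t : tensor H (tensor H L)) : U :=
  \tsum_(a, u <- t) \tsum_(b, c <- u) T a b c.
have lG : linear G by apply: tlift_is_linear.
have Gt x u : G (x ⊗ u) = \tsum_(b, c <- u) T x b c.
  by rewrite /G tlift_tens //; lin.
have := congr1 G (coactA a); rewrite !(linear_tlift _ _ lG) => E.
transitivity (\tsum_(a1, a0 <- coact a) G (a1 ⊗ coact a0)).
  rewrite -E; apply: eq_tlift => a1 a0; rewrite (linear_tlift _ _ lG).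
  by apply: eq_tlift => x y; rewrite Gt tlift_tens.
by apply: eq_tlift => x y; rewrite Gt.
Qed.

Section Bilinear.
Variables (U : lmodType k) (F : H -> L -> U).
Hypotheses (Fr : forall v, linear (F v)) (Fl : forall w, linear (F^~ w)).

Lemma tsum_coactM a b :
  \tsum_(x, y <- coact (a * b)) F x y =
  \tsum_(a1, a0 <- coact a) \tsum_(b1, b0 <- coact b) F (a1 * b1) (a0 * b0).
Proof.
have lF : linear (fun t => \tsum_(a, b <- t) F a b) by exact: tlift_is_linear.
rewrite coactM /tmul (linear_tlift _ _ lF); apply: eq_tlift => a1 a0.
rewrite (linear_tlift _ _ lF); apply: eq_tlift => b1 b0.
by rewrite tlift_tens.
Qed.

Lemma tsum_coact_counit (G : L -> U) a : linear G ->
  \tsum_(a1, a0 <- coact a) ⟨counit, a1⟩ *: G a0 = G a.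
Proof.
move=> lG; rewrite -{2}(coact_counit a) (linear_tlift _ _ lG).
by apply: eq_tlift => x y; rewrite fun_linearZ.
Qed.

Lemma tsum_coactSK a :
  \tsum_(a1, a0 <- coact a) \tsum_(b1, b0 <- coact a0) F (S a1 * b1) b0 = F 1 a.
Proof.
rewrite -(tsum_coactA (T := fun a c d => F (S a * c) d)); try lin.
rewrite -[RHS](tsum_coact_counit (G := F 1)) //; apply: eq_tlift => a1 a0.
by rewrite (tsum_antipodel (F := F^~ a0)).
Qed.

End Bilinear.
End Coaction.

Section Casimir.
Variables (k : fieldType) (L : falgType k) (F : frobSystem L).
Local Notation lam := (frob_form F).
Local Notation "⟨ f , x ⟩" := (f x : k).
Local Notation n := (\dim {:L}).
Local Notation A := (fun j : 'I_n => (frob_a F)`_j).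
Local Notation B := (fun j : 'I_n => nakayama F (frob_b F)`_j).

Lemma casimir_expandl x : x = \sum_j ⟨lam, B j * x⟩ *: A j.
Proof.
by rewrite [LHS](frob_a_expand F); apply: eq_bigr => j _;
  rewrite (nakayamaP F _`_j).
Qed.

Lemma casimir_expandr y : y = \sum_j ⟨lam, y * A j⟩ *: B j.
Proof.
apply: (@frob_nondeg _ _ F) => x.
rewrite {1}[x]casimir_expandl mulr_sumr mulr_suml !linear_sum /=.
apply: eq_bigr => j _.
by rewrite -scalerAr -scalerAl !linearZ /=; apply: mulrC.
Qed.
End Casimir.

Section Cointegral.
Variables (k : fieldType) (H : hopfAlg k) (L : comodAlg H).
Variables (I : integralData H) (Fr : frobSystem L) (gL : H).
Hypotheses (gg : grouplike gL) (coint : is_cointegral gL (frob_form Fr)).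
Implicit Types (U : lmodType k) (g h : H).
Local Notation S := (@antipode k H).
Local Notation α := (int_alpha I).
Local Notation gH := (int_g I).
Local Notation "⟨ f , x ⟩" := (f x : k).
Local Notation lam := (frob_form Fr).
Local Notation ν := (nakayama Fr).
Local Notation n := (\dim {:L}).
Local Notation A := (fun j : 'I_n => (frob_a Fr)`_j).
Local Notation B := (fun j : 'I_n => nakayama Fr (frob_b Fr)`_j).

Lemma tsum_cointegral U (F : H -> U) a : linear F ->
  \tsum_(a1, a0 <- coact a) ⟨lam, a0⟩ *: F a1 = ⟨lam, a⟩ *: F gL.
Proof.
move=> lF; rewrite -fun_linearZ // -coint (linear_tlift _ _ lF).
by apply: eq_tlift => x y; rewrite fun_linearZ.
Qed.

(** How the coaction passes through the Frobenius form; the counterpart for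
    comodule algebras of the invariance of [λ]. *)
Lemma tsum_coint_invariant U (F : H -> U) a b : linear F ->
  \tsum_(a1, a0 <- coact a) ⟨lam, b * a0⟩ *: F a1 =
  \tsum_(b1, b0 <- coact b) ⟨lam, b0 * a⟩ *: F (S b1 * gL).
Proof.
move=> lF.
transitivity (\tsum_(b1, b0 <- coact b) \tsum_(c1, c0 <- coact b0)
  \tsum_(a1, a0 <- coact a) (⟨lam, c0 * a0⟩ *: F (S b1 * c1 * a1))).
  rewrite (tsum_coactSK (F := fun u v =>
    \tsum_(a1, a0 <- coact a) ⟨lam, v * a0⟩ *: F (u * a1))); [|lin..].
  by apply: eq_tlift => a1 a0; rewrite mul1r.
apply: eq_tlift => b1 b0.
rewrite -(tsum_cointegral (F := fun x => F (S b1 * x))); last by lin.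
rewrite tsum_coactM; [|lin..].
by do 2!apply: eq_tlift => ? ?; rewrite mulrA.
Qed.

(** Moving the coaction across the Frobenius form twice, once on each side,
    compares the coactions of [ν a] and of [a].  In each move the antipode
    appears, whence the [S^2] on the left. *)
Lemma tsum_coact_nakayama U (F : H -> L -> U) a :
    (forall v, linear (F v)) -> (forall w, linear (F^~ w)) ->
  \tsum_(n1, n0 <- coact (ν a)) F (S (S n1)) n0 =
  \tsum_(a1, a0 <- coact a) F (gL * a1 * gL^-1) (ν a0).
Proof.
move=> Fr_ Fl.
have test b (G : H -> U) : linear G ->
  \tsum_(n1, n0 <- coact (ν a)) ⟨lam, n0 * b⟩ *: G (S (S n1)) =
  \tsum_(a1, a0 <- coact a) ⟨lam, ν a0 * b⟩ *: G (gL * a1 * gL^-1).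
  move=> lG; transitivity (\tsum_(a1, a0 <- coact a)
    (⟨lam, b * a0⟩ *: G (gL * a1 * gL^-1))); last first.
    by apply: eq_tlift => a1 a0; rewrite -nakayamaP.
  rewrite (tsum_coint_invariant (F := fun x => G (gL * x * gL^-1)));
    last by lin.
  transitivity (\tsum_(b1, b0 <- coact b) (⟨lam, ν a * b0⟩ *: G (gL * S b1))).
    rewrite (tsum_coint_invariant (F := fun x => G (gL * S x))); last by lin.
    apply: eq_tlift => n1 n0; rewrite antipodeM (grouplike_antipode gg) mulrA.
    by rewrite divrr ?mul1r // (grouplike_unit gg).
  apply: eq_tlift => b1 b0; rewrite -nakayamaP !mulrA mulrK //.
  exact: (grouplike_unit gg).
have expand x y : F x y = \sum_(j < n) ⟨lam, y * (frob_b Fr)`_j⟩ *: F x (A j).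
  rewrite {1}[y](frob_a_expand Fr).
  by rewrite fun_linear_sum //; apply: eq_bigr => j _; rewrite fun_linearZ.
under eq_tlift do rewrite expand.
under [RHS]eq_tlift do rewrite expand.
rewrite !tlift_sum; apply: eq_bigr => j _.
by rewrite (test _ (F^~ (A j))).
Qed.

Lemma int_alphaSS h : α (S (S h)) = α h.
Proof.
pose E a b c : k^o := ⟨α, S (S a)⟩ *: (⟨α, S b⟩ *: α c).
transitivity (\tsum_(a, r <- comul h) \tsum_(b, c <- comul r) E a b c).
  transitivity (⟨α, S (S h)⟩ *: (α 1 : k^o)).
    by rewrite int_alpha1; apply/esym/mulr1.
  rewrite -(tsum_SKr (F := fun x y => ⟨α, S (S x)⟩ *: α y)); [|lin..].
  do 2!apply: (@eq_tlift _ _ _ k^o) => ? ?.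
  by rewrite /E int_alphaM.
transitivity (⟨α, S 1⟩ *: (α h : k^o)); last first.
  by rewrite antipode1 int_alpha1; apply/mul1r.
rewrite -(tsum_SKl (F := fun x y => ⟨α, S x⟩ *: α y)); [|lin..].
do 2!apply: (@eq_tlift _ _ _ k^o) => ? ?.
by rewrite /E antipodeM int_alphaMl int_alphaM mulrC -int_alphaM.
Qed.

Lemma nakayama'E a :
  nakayama' I Fr a = \tsum_(a1, a0 <- coact a) ⟨α, a1⟩ *: ν a0.
Proof.
transitivity (\tsum_(n1, n0 <- coact (ν a)) ⟨α, S (S n1)⟩ *: n0).
  by apply: eq_tlift => x y; rewrite int_alphaSS.
rewrite (tsum_coact_nakayama (F := fun x y => ⟨α, x⟩ *: y)); [|lin..].
apply: eq_tlift => a1 a0; rewrite !int_alphaM mulrAC -int_alphaM.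
by rewrite mulrV ?(grouplike_unit gg) // int_alpha1 mul1r.
Qed.

(** The element [sum_j A_j ⊗ B_j] is dual to the Frobenius form, so this is
    [tsum_coint_invariant] in dual bases. *)
Lemma tsum_casimir U (F : H -> L -> L -> U) :
    (forall x y, linear (fun h => F h x y)) ->
    (forall h y, linear (fun x => F h x y)) ->
    (forall h x, linear (F h x)) ->
  \sum_j \tsum_(a1, a0 <- coact (A j)) F a1 a0 (B j) =
  \sum_j \tsum_(b1, b0 <- coact (B j)) F (S b1 * gL) (A j) b0.
Proof.
move=> F1 F2 F3.
have expandl h x y : F h x y = \sum_i ⟨lam, B i * x⟩ *: F h (A i) y.
  rewrite {1}[x](casimir_expandl Fr).
  rewrite (fun_linear_sum (f := fun x => F h x y)) //; apply: eq_bigr => j _.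
  by rewrite (fun_linearZ (f := fun x => F h x y)).
have expandr h x y : F h x y = \sum_i ⟨lam, y * A i⟩ *: F h x (B i).
  rewrite {1}[y](casimir_expandr Fr).
  by rewrite fun_linear_sum //; apply: eq_bigr => j _; rewrite fun_linearZ.
under eq_bigr => j _.
  under eq_tlift do rewrite expandl.
  rewrite tlift_sum; under eq_bigr => i _.
    rewrite (tsum_coint_invariant _ _ (F := fun h => F h (A i) (B j)));
      last by lin.
    over.
  over.
rewrite exchange_big; apply: eq_bigr => i _ /=.
rewrite -tlift_sum; apply: eq_tlift => b1 b0.
by rewrite [RHS]expandr.
Qed.

Local Notation c := (gH^-1 * gL).

(** Linearity of the twisted module structure comes down to this formula.
    Applying [S^2], which is injective, reduces it to [tsum_coact_nakayama]
    and Radford's formula; [gL] and [gH] commute because Radford's formula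
    holds for [gL]. *)
Lemma tsum_coact_nakayama' U (F : H -> L -> U) a :
    (forall v, linear (F v)) -> (forall w, linear (F^~ w)) ->
  \tsum_(x, y <- coact (nakayama' I Fr a)) F x y =
  \tsum_(a1, a0 <- coact a) F (c * S (S a1) * c^-1) (nakayama' I Fr a0).
Proof.
move=> Fr_ Fl; have ug := int_g_grouplike I.
have gc : grouplike c by apply: grouplikeM => //; exact: grouplikeV.
have uH := grouplike_unit ug; have uL := grouplike_unit gg.
have kerS : lker (antipode : 'End(H)) == 0%VS.
  rewrite -subv0; apply/subvP=> w; rewrite memv_ker memv0 => /eqP.
  by move/(antipode_eq0 I)->.
pose Si : 'End(H) := ((antipode : 'End(H))^-1)%VF.
have SiK h : Si (S h) = h by rewrite /Si lker0_lfunK.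
suff key (G : H -> L -> U) :
    (forall v, linear (G v)) -> (forall w, linear (G^~ w)) ->
    \tsum_(x, y <- coact (nakayama' I Fr a)) G (S (S x)) y =
    \tsum_(a1, a0 <- coact a) G (S (S (c * S (S a1) * c^-1)))
      (nakayama' I Fr a0).
  have := key (fun x y => F (Si (Si x)) y); rewrite /=.
  under eq_tlift do rewrite !SiK.
  under [X in _ -> _ -> _ = X]eq_tlift do rewrite !SiK.
  by apply; lin.
move=> Gr Gl.
have SS x : S (S (c * x * c^-1)) = c * S (S x) * c^-1.
  have E := (grouplike_antipode gc, grouplike_antipode
    (grouplikeV gc), @invrK H).
  by rewrite !(E, antipodeM).
have cE : c = gL * gH^-1.
  apply: (mulIr uH); rewrite mulrVK // -mulrA (grouplike_int_g_comm I gg).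
  by rewrite mulrA mulVr ?mul1r.
have cVE : c^-1 = gH * gL^-1 by rewrite cE invrM ?unitrV // invrK.
rewrite [in LHS]nakayama'E.
rewrite (linear_tlift (f := fun t => \tsum_(x, y <- coact t) G (S (S x)) y));
  last by lin.
transitivity (\tsum_(a1, a0 <- coact a) \tsum_(b1, b0 <- coact a0)
   (⟨α, a1⟩ *: G (gL * b1 * gL^-1) (ν b0))).
  apply: eq_tlift => a1 a0.
  rewrite (fun_linearZ (f := fun t => \tsum_(x, y <- coact t) G (S (S x)) y));
    last by lin.
  by rewrite tsum_coact_nakayama // tlift_scale.
rewrite -(tsum_coactA (T := fun a1 b1 b0 =>
  ⟨α, a1⟩ *: G (gL * b1 * gL^-1) (ν b0))); [|lin..].
transitivity (\tsum_(a1, a0 <- coact a) \tsum_(p, q <- comul a1)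
   (⟨α, q⟩ *: G (S (S (c * S (S p) * c^-1))) (ν a0))).
  apply: eq_tlift => a1 a0.
  have lG : linear (fun x => G (gL * x * gL^-1) (ν a0)) by lin.
  have := congr1 (fun x => G (gL * x * gL^-1) (ν a0)) (radford_S4 I a1).
  rewrite !(linear_tlift _ _ lG) => E.
  transitivity (\tsum_(p, q <- comul a1)
     G (gL * (⟨α, p⟩ *: q) * gL^-1) (ν a0)).
    by apply: eq_tlift => p q; rewrite (fun_linearZ _ _ lG).
  rewrite E; apply: eq_tlift => p q; rewrite (fun_linearZ _ _ lG) SS cVE cE.
  by rewrite !mulrA.
rewrite (tsum_coactA (T := fun p q a0 =>
  ⟨α, q⟩ *: G (S (S (c * S (S p) * c^-1))) (ν a0))); [|lin..].
apply: eq_tlift => a1 a0; rewrite nakayama'E.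
rewrite (linear_tlift (f := fun x => G (S (S (c * S (S a1) * c^-1))) x)) //.
by apply: eq_tlift => b1 b0; rewrite fun_linearZ.
Qed.
End Cointegral.

(** * Traces and evaluation on pure tensors *)

Section TensorExt.
Variables (k : fieldType) (V W : vectType k).

Lemma tens_ext (U : lmodType k) (f g : tensor V W -> U) :
  linear f -> linear g -> (forall v w, f (v ⊗ w) = g (v ⊗ w)) -> f =1 g.
Proof.
move=> lf lg fg t; rewrite -[t]tlift_id.
rewrite !(linear_tlift _ _ lf, linear_tlift _ _ lg).
exact: eq_tlift.
Qed.
End TensorExt.

Section Trace.
Variable k : fieldType.
Local Notation "⟨ f , x ⟩" := (f x : k).

(** The trace is taken of bare functions, because the endomorphisms met below
    are given by Sweedler expressions. *)
Definition lftrace (V : vectType k) (f : V -> V) : k :=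
  \sum_i coord (tbase V) i (f (tbase V)`_i).

(** A form of the independence of the trace from bases: any way of writing [f]
    as a sum of rank-one maps computes it. *)
Lemma lftrace_rank (V : vectType k) (J : finType) (f : V -> V)
    (psi : J -> V -> k^o) (v : J -> V) :
    (forall j, linear (psi j)) ->
    (forall x, f x = \sum_j ⟨psi j, x⟩ *: v j) ->
  lftrace f = \sum_j psi j (v j).
Proof.
move=> lpsi fE; rewrite /lftrace.
under eq_bigr do rewrite fE linear_sum.
rewrite exchange_big; apply: eq_bigr => j _.
rewrite {2}[v j]tbaseE fun_linear_sum //; apply: eq_bigr => i _.
by rewrite linearZ fun_linearZ //=; apply: mulrC.
Qed.

Lemma eq_lftrace (V : vectType k) (f g : V -> V) :
  f =1 g -> lftrace f = lftrace g.
Proof. by move=> fg; apply: eq_bigr => i _; rewrite fg. Qed.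

Lemma lftrace_sum (V : vectType k) (J : finType) (f : J -> V -> V) :
  lftrace (fun x => \sum_j f j x) = \sum_j lftrace (f j).
Proof.
by rewrite /lftrace exchange_big; apply: eq_bigr => i _; rewrite linear_sum.
Qed.

Lemma lftrace_tlift (V X Y : vectType k) (t : tensor X Y)
    (f : X -> Y -> V -> V) :
  lftrace (fun x => \tsum_(a, b <- t) f a b x) =
  \tsum_(a, b <- t) (lftrace (f a b) : k^o).
Proof.
rewrite /lftrace tlift_sum; apply: eq_bigr => i _.
by rewrite (linear_tlift (f := coord (tbase V) i : V -> k^o)) // => c x y;
  rewrite linearP.
Qed.

Lemma lin_lftrace (U : lmodType k) (V : vectType k) (f : U -> V -> V) :
  (forall x, linear (fun u => f u x)) -> linear (fun u => lftrace (f u) : k^o).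
Proof.
move=> lf c x y; rewrite /lftrace scaler_sumr -big_split; apply: eq_bigr => i _.
by rewrite lf linearP.
Qed.

Lemma lftrace_tens (X M : vectType k) (phi : X -> k^o) (x : X) (w : M -> M) :
    linear phi -> linear w ->
  lftrace (fun z : tensor X M => \tsum_(y, m <- z) ⟨phi, y⟩ *: (x ⊗ w m)) =
  phi x * lftrace w.
Proof.
move=> lphi lw.
pose psi j (z : tensor X M) : k^o :=
  \tsum_(y, m <- z) ⟨phi, y⟩ *: (coord (tbase M) j (w m) : k^o).
have lc j := @lin_coord _ _ _ (tbase M) j.
rewrite (lftrace_rank (psi := psi) (v := fun j => x ⊗ (tbase M)`_j)).
- rewrite mulr_sumr; apply: eq_bigr => j _; rewrite /psi tlift_tens //.
    by move=> v; apply: lin_scaler; apply: lin_comp.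
  by move=> v; apply: lin_scalel.
- by move=> j; rewrite /psi; lin.
move=> z; transitivity (\tsum_(y, m <- z) \sum_j
  (⟨phi, y⟩ *: (coord (tbase M) j (w m) *: (x ⊗ (tbase M)`_j)))).
  apply: eq_tlift => y m; rewrite -scaler_sumr; congr (_ *: _).
  rewrite {1}[w m]tbaseE fun_linear_sum; last by lin.
  by apply: eq_bigr => j _; rewrite (fun_linearZ (f := fun u => x ⊗ u)) //; lin.
rewrite tlift_sum; apply: eq_bigr => j _.
rewrite /psi (linear_tlift (f := fun u : k^o => (u : k) *: (x ⊗ (tbase M)`_j))).
  by apply: eq_tlift => y m; rewrite scalerA.
by apply: lin_scalel.
Qed.
End Trace.

Section Evaluation.
Variables (k : fieldType) (H : hopfAlg k) (L : comodAlg H).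
Implicit Types (X Y : rep H) (M N : rep L).
Local Notation "⟨ f , x ⟩" := (f x : k).

Lemma tens_repE X M a x m :
  rep_act (X ▷ M) a (x ⊗ m) =
  \tsum_(a1, a0 <- coact a) rep_act X a1 x ⊗ rep_act M a0 m.
Proof.
rewrite [rep_act _]/(tens_act _ _) tens_actE.
rewrite (linear_tlift (f := fun g : 'End(tensor X M) => g (x ⊗ m)));
  last by lin.
by apply: eq_tlift => a1 a0; rewrite tmap_tens.
Qed.

Lemma regular_repE (A : falgType k) (a b : A) :
  rep_act (regular_rep A) a b = a * b.
Proof. by rewrite /= /reg_act lfunE /= lfunE. Qed.

Lemma hrepE M a h m :
  rep_act (hrep M) a (h ⊗ m) =
  \tsum_(a1, a0 <- coact a) (a1 * h) ⊗ rep_act M a0 m.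
Proof.
by rewrite tens_repE; apply: eq_tlift => a1 a0; rewrite regular_repE.
Qed.

Lemma ihom_compE M1 M2 M3 (f : 'Hom(hrep M2, M3)) (g : 'Hom(hrep M1, M2)) h m :
  ihom_comp f g (h ⊗ m) = \tsum_(h1, h2 <- comul h) f (h1 ⊗ g (h2 ⊗ m)).
Proof. by rewrite lin_lfunE ?tlift_tens //; lin. Qed.

Lemma ihom_aE X M N (x : X) (xi : 'Hom(hrep M, N)) h m :
  ihom_a x xi (h ⊗ m) = \tsum_(h1, h2 <- comul h) rep_act X h1 x ⊗ xi (h2 ⊗ m).
Proof. by rewrite lin_lfunE ?tlift_tens //; lin. Qed.

Lemma ihom_bE M N Y (xi : 'Hom(hrep M, N)) (y : Y) h (y' : 'Hom(Y, k^o)) m :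
  ihom_b xi y (h ⊗ ((y' : dual_space Y) ⊗ m)) = \tsum_(h1, h2 <- comul h)
      ⟨y', rep_act Y h2 y⟩ *: xi (h1 ⊗ m).
Proof. by rewrite lin_lfunE ?tlift_tens //; lin. Qed.

Lemma ldualE X h (f : 'Hom(X, k^o)) x :
  (rep_act (ldual X) h f : 'Hom(X, k^o)) x = f (rep_act X (antipode h) x).
Proof.
by rewrite [rep_act _]/(dual_act _ _) dual_actE dual_mapE comp_lfunE.
Qed.

Lemma bidualE (V : vectType k) (v : V) (f : 'Hom(V, k^o)) :
  (bidual V v : 'Hom(dual_space V, k^o)) f = f v.
Proof.
have lv u : linear (fun p : dual_space V => (p : 'Hom(V, k^o)) u).
  by move=> c p q; rewrite add_lfunE scale_lfunE.
rewrite /bidual lin_lfunE ?lin_lfunE // => c u v'.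
apply/lfunP => p; rewrite add_lfunE scale_lfunE !lin_lfunE //.
by rewrite linearP.
Qed.
End Evaluation.

(** * Averaging linear maps over a Frobenius algebra *)

Section Higman.
Variables (k : fieldType) (L : falgType k) (Fr : frobSystem L).
Local Notation lam := (frob_form Fr).
Local Notation "⟨ f , x ⟩" := (f x : k).
Local Notation n := (\dim {:L}).
Local Notation A := (fun j : 'I_n => (frob_a Fr)`_j).
Local Notation B := (fun j : 'I_n => nakayama Fr (frob_b Fr)`_j).

Lemma rep_actMx (M : rep L) a b m :
  rep_act M (a * b) m = rep_act M a (rep_act M b m).
Proof. by rewrite rep_actM comp_lfunE. Qed.

Lemma rep_act1x (M : rep L) m : rep_act M 1 m = m.
Proof. by rewrite rep_act1 id_lfunE. Qed.

(** The relative trace of Higman, from linear to L-linear maps. *)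
Definition higman (P N : rep L) (f : 'Hom(P, N)) : 'Hom(P, N) :=
  \sum_j (rep_act N (A j) \o f \o rep_act P (B j))%VF.

Lemma higmanE (P N : rep L) (f : 'Hom(P, N)) x :
  higman f x = \sum_j rep_act N (A j) (f (rep_act P (B j) x)).
Proof. by rewrite sum_lfunE; apply: eq_bigr => j _; rewrite !comp_lfunE. Qed.

(** The Casimir element commutes with [L]: expand [a A_j] in the [A_i] and
    [B_i a] in the [B_j]; the coefficients agree. *)
Lemma casimir_comm (U : lmodType k) (T : L -> L -> U) a :
    (forall v, linear (T v)) -> (forall w, linear (T^~ w)) ->
  \sum_j T (a * A j) (B j) = \sum_j T (A j) (B j * a).
Proof.
move=> Tr Tl.
transitivity (\sum_j \sum_i ⟨lam, B i * (a * A j)⟩ *: T (A i) (B j)).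
  apply: eq_bigr => j _; rewrite {1}[a * _](casimir_expandl Fr).
  rewrite (fun_linear_sum (f := T^~ (B j))) //; apply: eq_bigr => i _.
  by rewrite (fun_linearZ (f := T^~ (B j))).
rewrite exchange_big; apply: eq_bigr => i _ /=.
rewrite [B i * a](casimir_expandr Fr) fun_linear_sum //.
by apply: eq_bigr => j _; rewrite fun_linearZ // mulrA.
Qed.

Lemma higman_hom (P N : rep L) (f : 'Hom(P, N)) : is_hom (higman f).
Proof.
move=> a x; rewrite !higmanE [RHS]linear_sum.
have := casimir_comm (T := fun u v => rep_act N u (f (rep_act P v x))) a.
move=> E; transitivity (\sum_j rep_act N (A j) (f (rep_act P (B j * a) x))).
  by apply: eq_bigr => j _; rewrite rep_actMx.
by rewrite -E; [apply: eq_bigr => j _; rewrite rep_actMx|lin..].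
Qed.

Section Free.
Variable V : vectType k.

(** [L ⊗ V] with [L] acting on the first factor: a free module that is already
    a tensor product, so that coordinates in [V] give its dual family. *)
Definition free_act : 'Hom(L, 'End(tensor L V)) :=
  linfun (fun a => tmap (rep_act (regular_rep L) a) \1%VF).

Lemma free_actE a b v : free_act a (b ⊗ v) = (a * b) ⊗ v.
Proof.
rewrite lin_lfunE; last by move=> c x y; rewrite linearP tmap_linl.
by rewrite tmap_tens id_lfunE; congr (_ ⊗ _); exact: regular_repE.
Qed.

Lemma free_act1 : free_act 1 = \1%VF.
Proof.
apply/lfunP; apply: tens_ext => [||b v]; [lin|lin|].
by rewrite free_actE mul1r id_lfunE.
Qed.

Lemma free_actM a b : free_act (a * b) = (free_act a \o free_act b)%VF.
Proof.
apply/lfunP; apply: tens_ext => [||c v]; [lin|lin|].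
by rewrite comp_lfunE !free_actE mulrA.
Qed.

Definition free_rep : rep L := Rep free_act1 free_actM.
End Free.

Lemma regular_projective : projective (regular_rep L).
Proof.
move=> M N p f hp sp hf; have [m pm] := sp (f 1).
have lg : linear (fun a : L => rep_act M a m) by lin.
exists (linfun (fun a : L => rep_act M a m)).
  by move=> a b; rewrite regular_repE !lin_lfunE // rep_actMx.
by move=> a; rewrite lin_lfunE // hp pm -hf regular_repE mulr1.
Qed.

End Higman.

Section DualFamily.
Variables (k : fieldType) (H : hopfAlg k) (L : comodAlg H).

(** Split the action map [L ⊗ P -> P] and take coordinates in [P]. *)
Lemma projective_dual_family (P : rep L) : projective P ->
  exists n (t : 'I_n -> P) (t' : 'I_n -> 'Hom(P, regular_rep L)),
    dual_family t t'.
Proof.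
move=> projP.
pose p : 'Hom(free_rep L P, P) := linfun (fun z : tensor L P =>
  \tsum_(a, x <- z) rep_act P a x).
have pE a x : p (a ⊗ x) = rep_act P a x.
  by rewrite lin_lfunE ?tlift_tens //; lin.
have hp : is_hom p.
  move=> a; apply: tens_ext => [||b x]; [lin|lin|].
  by rewrite free_actE !pE rep_actMx.
have sp : surjective p by move=> x; exists (1 ⊗ x); rewrite pE rep_act1x.
have h1 : is_hom (\1%VF : 'Hom(P, P)) by move=> a m; rewrite !id_lfunE.
have [s hs sK] := projP _ _ p _ hp sp h1.
pose c i (z : tensor L P) : L := \tsum_(a, x <- z) (coord (tbase P) i x *: a).
have lc i : linear (c i) by rewrite /c; lin.
have cE i a x : c i (a ⊗ x) = coord (tbase P) i x *: a.
  rewrite /c tlift_tens //; last by lin.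
  by move=> v; apply: lin_scalel => u y z; rewrite linearP.
exists (\dim {:P}), (fun i => (tbase P)`_i), (fun i => linfun (c i \o s)).
have E i x : linfun (c i \o s) x = c i (s x).
  by rewrite lin_lfunE //; apply: lin_comp => //; lin.
split=> [i a x|x].
  rewrite !E hs regular_repE; move: (s x); apply: tens_ext.
  - by apply: lin_comp => //; lin.
  - by lin.
  by move=> b y; rewrite free_actE !cE scalerAr.
under eq_bigr do rewrite E.
rewrite -[RHS]id_lfunE -sK; move: (s x); apply: tens_ext; [lin|lin|].
move=> a y; rewrite pE {2}[y]tbaseE linear_sum; apply: eq_bigr => i _.
by rewrite cE !linearZ scale_lfunE.
Qed.

Variables (Fr : frobSystem L).
Local Notation lam := (frob_form Fr).
Local Notation "⟨ f , x ⟩" := (f x : k).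
Local Notation n := (\dim {:L}).
Local Notation A := (fun j : 'I_n => (frob_a Fr)`_j).
Local Notation B := (fun j : 'I_n => nakayama Fr (frob_b Fr)`_j).

(** The coefficients [λ_L(B_j t^i(x))] of [t^i(x)] in the [A_j] appear in the
    average, which is therefore [sum_i t^i(x) eta(t_i) = eta(x)]. *)
Lemma hom_higman (P N : rep L) (eta : 'Hom(P, N)) (n : nat)
    (t : 'I_n -> P) (t' : 'I_n -> 'Hom(P, regular_rep L)) :
  dual_family t t' -> is_hom eta ->
  eta = higman Fr (linfun (fun x => \sum_i ⟨lam, t' i x⟩ *: eta (t i))).
Proof.
move=> [t'h tE] etah; apply/lfunP => x; rewrite higmanE.
transitivity (\sum_i rep_act N (t' i x) (eta (t i))).
  rewrite -{1}[x]tE linear_sum; apply: eq_bigr => i _; exact: etah.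
transitivity (\sum_j \sum_i ⟨lam, B j * t' i x⟩ *: rep_act N (A j) (eta (t i))).
  rewrite exchange_big; apply: eq_bigr => i _ /=.
  have lN : linear (fun a => rep_act N a (eta (t i))) by lin.
  rewrite {1}[t' i x : L](casimir_expandl Fr) (fun_linear_sum _ _ _ lN).
  by apply: eq_bigr => j _; rewrite (fun_linearZ _ _ lN).
apply: eq_bigr => j _; rewrite lin_lfunE; last by lin.
rewrite linear_sum; apply: eq_bigr => i _.
by rewrite linearZ t'h regular_repE.
Qed.

End DualFamily.

(** * The Serre pairing as an ordinary trace *)

Section Pairing.
Variables (k : fieldType) (H : hopfAlg k) (L : comodAlg H).
Variables (I : integralData H) (Fr : frobSystem L) (gL : H).
Hypotheses (gg : grouplike gL) (coint : is_cointegral gL (frob_form Fr)).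
Hypothesis exL : exact_comodAlg L.
Implicit Types (U : lmodType k) (g h : H) (M N : rep L).
Local Notation S := (@antipode k H).
Local Notation Λ := (int_elt I).
Local Notation "⟨ f , x ⟩" := (f x : k).
Local Notation lam := (frob_form Fr).
Local Notation ν := (nakayama Fr).
Local Notation n := (\dim {:L}).
Local Notation A := (fun j : 'I_n => (frob_a Fr)`_j).
Local Notation B := (fun j : 'I_n => nakayama Fr (frob_b Fr)`_j).

(** The reason for the twist in the definition of the Serre functor. *)
Lemma nakayama_act M a m :
  rep_act (hrep M) (ν a) (Λ ⊗ m) = Λ ⊗ rep_act M (nakayama' I Fr a) m.
Proof.
rewrite hrepE /nakayama'.
rewrite (linear_tlift (f := fun x => Λ ⊗ rep_act M x m)); last by lin.
apply: eq_tlift => a1 a0; rewrite int_alphaP tensZl.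
by rewrite (fun_linearZ (f := fun x => Λ ⊗ rep_act M x m)) //; lin.
Qed.

(** Up to tensoring with [Λ], the map whose average is the endomorphism of
    [H ▷ M] in the Serre trace. *)
Definition pairing_op M N (zeta : 'Hom(hrep N, serre I Fr M))
    (f : 'Hom(hrep M, N)) (x : tensor H M) : M :=
  \tsum_(h, m <- x) \tsum_(h1, h2 <- comul h)
     (zeta ((gL^-1 * h1) ⊗ f (h2 ⊗ m)) : M).

Lemma lin_pairing_op M N zeta f : linear (@pairing_op M N zeta f).
Proof. by rewrite /pairing_op; lin. Qed.

Lemma pairing_opE M N zeta f h m : @pairing_op M N zeta f (h ⊗ m) =
  \tsum_(h1, h2 <- comul h) (zeta ((gL^-1 * h1) ⊗ f (h2 ⊗ m)) : M).
Proof. by rewrite /pairing_op tlift_tens //; lin. Qed.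

(** The Casimir element is pulled out of both slots of [zeta].  On the left,
    [A_j] has to pass the leg [h_1]; by [tsum_casimir] its coaction becomes
    [S(B_-1) gL], which cancels against [gL^-1] and the part of the coaction of
    [B_j] acting on [h_1]. *)
Lemma comp_higman M N (zeta : 'Hom(hrep N, serre I Fr M))
    (f : 'Hom(hrep M, N)) x :
    is_hom zeta ->
  Λ ⊗ ihom_comp zeta (higman Fr f) x =
  \sum_j rep_act (hrep M) (ν (A j))
    (Λ ⊗ pairing_op zeta f (rep_act (hrep M) (B j) x)) :> tensor H M.
Proof.
move=> hz; move: x; apply: tens_ext; [by lin| |move=> h m].
  apply: lin_sum => j; apply: lin_lfun; apply: lin_tensr.
  by apply: lin_comp; [apply: lin_pairing_op|lin].
(* [x] and [y] will be the two parts of the coaction of [A_j], and [z] will be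
   [B_j]. *)
pose T (x : H) (y z : L) : tensor H M :=
  \tsum_(b1, b0 <- coact z) \tsum_(p, q <- comul b1) \tsum_(h1, h2 <- comul h)
    (Λ ⊗ zeta ((x * (gL^-1 * (p * h1))) ⊗
       rep_act N y (f ((q * h2) ⊗ rep_act M b0 m)))).
transitivity (\sum_j \tsum_(a1, a0 <- coact (A j)) T a1 a0 (B j)); last first.
  apply: eq_bigr => j _; rewrite nakayama_act.
  rewrite -(serre_actE I Fr M) -[serre_act _ _ _]/(rep_act (serre I Fr M)).
  rewrite hrepE (linear_tlift (f := fun x : tensor H M =>
    Λ ⊗ rep_act (serre I Fr M) (A j) (pairing_op zeta f x))); last first.
    by apply: lin_tensr; apply: lin_lfun; apply: lin_pairing_op.
  rewrite /T exchange_tlift; apply: eq_tlift => b1 b0.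
  rewrite pairing_opE tsum_comulM; [|lin..].
  rewrite (linear_tlift (f := fun x : M =>
    Λ ⊗ rep_act (serre I Fr M) (A j) x)); last by lin.
  rewrite exchange_tlift; apply: eq_tlift => p q.
  rewrite (linear_tlift (f := fun x : M =>
    Λ ⊗ rep_act (serre I Fr M) (A j) x)); last by lin.
  rewrite exchange_tlift; apply: eq_tlift => h1 h2.
  rewrite -hz hrepE (linear_tlift (f := fun x : tensor H N => Λ ⊗ zeta x)) //;
    lin.
rewrite (tsum_casimir coint (F := T)); try by rewrite /T; lin.
rewrite ihom_compE (linear_tlift (f := fun x : M => Λ ⊗ x)); last by lin.
transitivity (\tsum_(h1, h2 <- comul h) \sum_j
    (Λ ⊗ zeta (h1 ⊗ rep_act N (A j) (f (rep_act (hrep M) (B j) (h2 ⊗ m)))))).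
  apply: eq_tlift => h1 h2; rewrite higmanE.
  by rewrite (fun_linear_sum (f := fun x => Λ ⊗ zeta (h1 ⊗ x))) //; lin.
rewrite tlift_sum; apply: eq_bigr => j _.
pose G x y z : tensor H M := \tsum_(h1, h2 <- comul h)
  (Λ ⊗ zeta ((x * h1) ⊗ rep_act N (A j) (f ((y * h2) ⊗ rep_act M z m)))).
transitivity (\tsum_(b1, b0 <- coact (B j)) G 1 b1 b0).
  rewrite /G exchange_tlift; apply: eq_tlift => h1 h2.
  rewrite hrepE mul1r.
  by rewrite (linear_tlift (f := fun x : tensor H M =>
    Λ ⊗ zeta (h1 ⊗ rep_act N (A j) (f x)))) //; lin.
rewrite -(tsum_coactSK (F := fun u v => \tsum_(b1, b0 <- coact v) G u b1 b0));
  try by rewrite /G; lin.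
apply: eq_tlift => b1 b0.
rewrite -(tsum_coactA (T := fun p q z => G (S b1 * p) q z)); try by rewrite /G;
  lin.
apply: eq_tlift => c1 c0; apply: eq_tlift => p q; apply: eq_tlift => h1 h2.
by rewrite -!mulrA mulVKr // (grouplike_unit gg).
Qed.

Lemma hrep_dual_family M : exists n (t : 'I_n -> hrep M)
  (t' : 'I_n -> 'Hom(hrep M, regular_rep L)), dual_family t t'.
Proof. exact/projective_dual_family/exL/regular_projective. Qed.

(** The twisted trace of [sum_j ν(A_j) K(B_j -)] is the ordinary trace of [K]:
    with a dual family [t_i, t^i], the map [K] is the sum of the rank-one maps
    [x |-> λ_L(t^i(K x) A_j) B_j t_i].  In particular the value does not depend
    on the dual family. *)
Lemma pairing_higman M N (zeta : 'Hom(hrep N, serre I Fr M))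
    (f : 'Hom(hrep M, N)) :
    is_hom zeta ->
  serre_pairing zeta (higman Fr f) =
  lftrace (fun m => pairing_op zeta f (Λ ⊗ m)).
Proof.
move=> hz; rewrite /serre_pairing /serre_trace.
have lop := lin_pairing_op zeta f.
set P := (X in xget _ X).
have /xgetPex : exists c, P c.
  have [d [t [t' tt']]] := hrep_dual_family M.
  by exists (\sum_i lam (t' i (Λ ⊗ ihom_comp zeta (higman Fr f)
    (t i)))), d, t, t'.
move/(_ 0) => [d [t [t' [[t'h tE] ->]]]].
transitivity (lftrace (fun x : tensor H M => Λ ⊗ pairing_op zeta f x)).
  pose psi (p : 'I_d * 'I_n) (x : tensor H M) : k^o :=
    lam (t' p.1 (Λ ⊗ pairing_op zeta f x) * A p.2).
  rewrite (lftrace_rank (psi := psi)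
     (v := fun p => rep_act (hrep M) (B p.2) (t p.1))).
  - rewrite -(pair_bigA _ (fun i j => psi (i, j) (rep_act (hrep M) (B j)
    (t i)))) /=.
    apply: eq_bigr => i _; rewrite comp_higman // !linear_sum.
    apply: eq_bigr => j _; rewrite /psi /= [RHS]nakayamaP.
    by congr (lam _); rewrite t'h regular_repE.
  - by move=> p; rewrite /psi; apply: lin_lfun; apply: (@lin_mull k L); lin.
  move=> x; rewrite -[LHS](tE _).
  rewrite -(pair_bigA _ (fun i j => (psi (i, j) x : k) *: rep_act (hrep M)
    (B j) (t i))) /=.
  apply: eq_bigr => i _.
  have lr : linear (fun a => rep_act (hrep M) a (t i)) by lin.
  rewrite {1}[t' i _ : L](casimir_expandr Fr) (fun_linear_sum _ _ _ lr).
  by apply: eq_bigr => j _; rewrite (fun_linearZ _ _ lr).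
apply: (lftrace_rank (psi := fun j x => coord (tbase M) j (pairing_op zeta f x))
  (v := fun j => Λ ⊗ (tbase M)`_j)) => [j|x].
  by apply: lin_comp => // c u v; rewrite linearP.
rewrite {1}[pairing_op _ _ x]tbaseE (fun_linear_sum (f := fun x : M => Λ ⊗ x));
  last by lin.
by apply: eq_bigr => j _; rewrite (fun_linearZ (f := fun x : M => Λ ⊗ x)) //;
  lin.
Qed.
End Pairing.

(** * The twisted module structure *)

Section Bidual.
Variables (k : fieldType) (V : vectType k).
Local Notation "⟨ f , x ⟩" := (f x : k).

Lemma dual_separates (v w : V) :
  (forall f : 'Hom(V, k^o), f v = f w) -> v = w.
Proof.
move=> vw; rewrite [v]tbaseE [w]tbaseE; apply: eq_bigr => i _; congr (_ *: _).
have lc := @lin_coord _ _ _ (tbase V) i.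
by have := vw (linfun (coord (tbase V) i : V -> k^o)); rewrite !lin_lfunE.
Qed.

Lemma bidual_inj : lker (bidual V) == 0%VS.
Proof.
apply/lker0P => v w vw; apply: dual_separates => f.
by rewrite -[LHS]bidualE vw bidualE.
Qed.

Lemma bidual_surj p : exists v, p = bidual V v.
Proof.
have: p \in limg (bidual V).
  suff ->: limg (bidual V) = fullv by rewrite memvf.
  apply/eqP; rewrite eqEdim subvf limg_dim_eq;
    last by rewrite (eqP bidual_inj) capv0.
  have dE (W : vectType k) : dim (dual_space W) = dim W by rewrite /dim /=
    muln1.
  by rewrite !dimvf !dE leqnn.
by case/memv_imgP=> w _ ->; exists w.
Qed.

Lemma tbase_expand (U : lmodType k) (F : V -> U) v : linear F ->
  F v = \sum_i ⟨linfun (coord (tbase V) i : V -> k^o), v⟩ *: F (tbase V)`_i.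
Proof.
move=> lF; rewrite {1}[v]tbaseE fun_linear_sum //; apply: eq_bigr => i _.
by rewrite fun_linearZ // lin_lfunE // => c x y; rewrite linearP.
Qed.
End Bidual.

Section Twisted.
Variables (k : fieldType) (H : hopfAlg k) (L : comodAlg H).
Variables (I : integralData H) (Fr : frobSystem L) (gL : H).
Hypotheses (gg : grouplike gL) (coint : is_cointegral gL (frob_form Fr)).
Hypothesis exL : exact_comodAlg L.
Implicit Types (U : lmodType k) (g h : H) (M N : rep L) (X : rep H).
Local Notation S := (@antipode k H).
Local Notation α := (int_alpha I).
Local Notation gH := (int_g I).
Local Notation Λ := (int_elt I).
Local Notation λ := (int_form I).
Local Notation "⟨ f , x ⟩" := (f x : k).
Local Notation lam := (frob_form Fr).
Local Notation n := (\dim {:L}).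
Local Notation A := (fun j : 'I_n => (frob_a Fr)`_j).
Local Notation B := (fun j : 'I_n => nakayama Fr (frob_b Fr)`_j).
Local Notation c := (gH^-1 * gL).
Local Notation serre := (serre I Fr).

(** The inverse of the map in the theorem: the canonical isomorphism from the
    double dual, followed by [c = (gL^-1 gH)^-1]. *)
Definition serre_twist X M : 'Hom(ldual (ldual X) ▷ serre M, serre (X ▷ M)) :=
  tmap (rep_act X c \o (bidual X)^-1)%VF \1%VF.

Lemma serre_twistE X M x m :
  serre_twist X M (bidual X x ⊗ m) = rep_act X c x ⊗ m.
Proof. by rewrite tmap_tens comp_lfunE lker0_lfunK ?id_lfunE // bidual_inj. Qed.

Lemma bidual_act X h x :
  rep_act (ldual (ldual X)) h (bidual X x) = bidual X (rep_act X (S (S h)) x).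
Proof.
apply/lfunP => f; rewrite ldualE.
by rewrite [LHS]bidualE [RHS]bidualE ldualE.
Qed.

Lemma grouplike_c : grouplike c.
Proof.
by apply: grouplikeM => //; apply: grouplikeV; exact: int_g_grouplike.
Qed.

Lemma serreE M a m : rep_act (serre M) a m = rep_act M (nakayama' I Fr a) m.
Proof. by rewrite /= serre_actE. Qed.

Lemma serre_twist_hom X M : is_hom (serre_twist X M).
Proof.
move=> a; apply: tens_ext; [by lin|by lin|move=> p m].
have [x ->] := bidual_surj p; rewrite serre_twistE serreE !tens_repE.
rewrite (tsum_coact_nakayama' I gg coint (F := fun u v =>
  rep_act X u (rep_act X c x) ⊗ rep_act M v m)); [|lin..].
rewrite (linear_tlift (f := serre_twist X M)); last by lin.
apply: eq_tlift => a1 a0; rewrite bidual_act serre_twistE serreE.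
rewrite -!rep_actMx mulrVK ?mulrA // grouplike_unit //; exact: grouplike_c.
Qed.

Lemma serre_twist_bij X M : bijective (serre_twist X M).
Proof.
have uc := grouplike_unit grouplike_c.
exists (tmap (bidual X \o rep_act X (c^-1)%R)%VF \1%VF : 'Hom(tensor X M,
  tensor _ M)).
- apply: tens_ext; [by lin|by lin|move=> p m].
  have [x ->] := bidual_surj p.
  by rewrite serre_twistE tmap_tens comp_lfunE id_lfunE -rep_actMx mulVr //
    rep_act1x.
- apply: tens_ext; [by lin|by lin|move=> x m].
  rewrite tmap_tens comp_lfunE id_lfunE serre_twistE -rep_actMx.
  by rewrite divrr // rep_act1x.
Qed.

Lemma serre_twist_natural X X' M M' (f : 'Hom(X, X')) (g : 'Hom(M, M')) :
  is_hom f -> is_hom g ->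
  (serre_twist X' M' \o tmap (dual_map (dual_map f)) g =
   tmap f g \o serre_twist X M)%VF.
Proof.
move=> hf hg; apply/lfunP; apply: tens_ext; [by lin|by lin|move=> p m].
have [x ->] := bidual_surj p; rewrite !comp_lfunE serre_twistE.
rewrite (tmap_tens (dual_map (dual_map f)) g) (tmap_tens f g).
have -> : dual_map (dual_map f) (bidual X x) = bidual X' (f x).
  apply/lfunP => q.
  by rewrite [RHS]bidualE dual_mapE comp_lfunE [LHS]bidualE dual_mapE
    comp_lfunE.
by rewrite serre_twistE hf.
Qed.

(** The formula of [ihom_b], composed with the identification of [X] and its
    double dual, applied to a map that need not be L-linear. *)
Definition lin_ihom_b X M N (f : 'Hom(hrep M, N)) (q : 'Hom(X, k^o)) :
    'Hom(hrep (X ▷ M), N) :=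
  linfun (fun t : tensor H (tensor X M) =>
    \tsum_(h, u <- t) \tsum_(y, m <- u) \tsum_(h1, h2 <- comul h)
      ⟨q, rep_act X (S h2) y⟩ *: f (h1 ⊗ m)).

Lemma lin_ihom_bE X M N (f : 'Hom(hrep M, N)) (q : 'Hom(X, k^o)) h y m :
  lin_ihom_b f q (h ⊗ (y ⊗ m)) =
  \tsum_(h1, h2 <- comul h) ⟨q, rep_act X (S h2) y⟩ *: f (h1 ⊗ m).
Proof. by rewrite lin_lfunE ?tlift_tens //; lin. Qed.

Lemma tens_ext3 (U : lmodType k) (V W Z : vectType k)
    (f g : tensor V (tensor W Z) -> U) : linear f -> linear g ->
  (forall v w z, f (v ⊗ (w ⊗ z)) = g (v ⊗ (w ⊗ z))) -> f =1 g.
Proof.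
move=> lf lg fg; apply: tens_ext => // v; apply: tens_ext => //;
  apply: lin_comp => //.
  exact: tens_linr.
exact: tens_linr.
Qed.

(** Averaging commutes with the right module structure: in
    [S(B_-2 h_2) B_-1 y] the two parts of the coaction cancel. *)
Lemma ihom_b_higman X M N (f : 'Hom(hrep M, N)) (q : ldual X) :
  (ihom_b (higman Fr f) q \o tmap \1 (tmap (bidual X) \1))%VF =
  higman Fr (lin_ihom_b f (q : 'Hom(X, k^o))).
Proof.
apply/lfunP; apply: tens_ext3; [by lin|by lin|move=> h y m].
rewrite comp_lfunE !tmap_tens !id_lfunE ihom_bE.
transitivity (\sum_j rep_act N (A j) (lin_ihom_b f (q : 'Hom(X, k^o))
  (rep_act (hrep (X ▷ M)) (B j) (h ⊗ (y ⊗ m))))); last first.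
  apply: esym; exact: (@higmanE k L Fr (hrep (X ▷ M)) N (lin_ihom_b f
    (q : 'Hom(X, k^o))) (h ⊗ (y ⊗ m))).
pose T j : H -> H -> L -> N := fun u v z => \tsum_(h1, h2 <- comul h)
  (⟨(q : 'Hom(X, k^o)), rep_act X (S h2 * v) y⟩ *:
   rep_act N (A j) (f ((u * h1) ⊗ rep_act M z m))).
transitivity (\sum_j \tsum_(b1, b0 <- coact (B j)) T j b1 1 b0).
  transitivity (\sum_j \tsum_(h1, h2 <- comul h) \tsum_(b1, b0 <- coact (B j))
    (⟨(q : 'Hom(X, k^o)), rep_act X (S h2) y⟩ *:
   rep_act N (A j) (f ((b1 * h1) ⊗ rep_act M b0 m)))).
    rewrite -tlift_sum; apply: eq_tlift => h1 h2.
    rewrite bidualE ldualE higmanE scaler_sumr; apply: eq_bigr => j _.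
    rewrite hrepE -tlift_scale; congr (_ *: _).
    by rewrite (linear_tlift (f := fun x : tensor H M =>
      rep_act N (A j) (f x))) //; lin.
  apply: eq_bigr => j _; rewrite exchange_tlift; apply: eq_tlift => b1 b0.
  by apply: eq_tlift => h1 h2; rewrite mulr1.
apply: eq_bigr => j _.
transitivity (\tsum_(p, x <- coact (B j)) \tsum_(r, z <- coact x)
    \tsum_(c1, c0 <- coact z) T j p (S r * c1) c0).
  apply: eq_tlift => p x.
  by rewrite (tsum_coactSK (F := T j p)) //; rewrite /T; lin.
rewrite hrepE (linear_tlift (f := fun x : tensor H (tensor X M) =>
   rep_act N (A j) (lin_ihom_b f (q : 'Hom(X, k^o)) x))); last by lin.
transitivity (\tsum_(b1, b0 <- coact (B j)) \tsum_(p, r <- comul b1)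
    \tsum_(c1, c0 <- coact b0) T j p (S r * c1) c0).
  rewrite (tsum_coactA (T := fun p r z => \tsum_(c1, c0 <- coact z)
     T j p (S r * c1) c0)) //; rewrite /T; lin.
apply: eq_tlift => b1 b0; rewrite tens_repE exchange_tlift.
rewrite (linear_tlift (f := fun x : tensor X M =>
   rep_act N (A j) (lin_ihom_b f (q : 'Hom(X, k^o)) ((b1 * h) ⊗ x))));
     last by lin.
apply: eq_tlift => c1 c0; rewrite lin_ihom_bE tsum_comulM; [|lin..].
rewrite (linear_tlift (f := rep_act N (A j))); last by lin.
apply: eq_tlift => p r; rewrite (linear_tlift (f := rep_act N (A j)));
  last by lin.
apply: eq_tlift => h1 h2.
by rewrite fun_linearZ ?antipodeM -?rep_actMx -?mulrA //; lin.
Qed.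

Lemma ihom_a_hom X M N (x : X) (zeta : 'Hom(hrep M, N)) :
  is_hom zeta -> is_hom (ihom_a x zeta).
Proof.
move=> hz a; apply: tens_ext; [by lin|by lin|move=> h m].
rewrite hrepE (linear_tlift (f := ihom_a x zeta)); last by lin.
rewrite ihom_aE (linear_tlift (f := rep_act (X ▷ N) a)); last by lin.
transitivity (\tsum_(a1, a0 <- coact a) \tsum_(p, q <- comul a1)
   \tsum_(h1, h2 <- comul h)
   (rep_act X (p * h1) x ⊗ zeta ((q * h2) ⊗ rep_act M a0 m))).
  apply: eq_tlift => a1 a0; rewrite ihom_aE tsum_comulM //; lin.
rewrite (tsum_coactA (T := fun p q a0 => \tsum_(h1, h2 <- comul h)
   (rep_act X (p * h1) x ⊗ zeta ((q * h2) ⊗ rep_act M a0 m)))); [|lin..].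
transitivity (\tsum_(a1, a0 <- coact a) \tsum_(h1, h2 <- comul h)
   \tsum_(b1, b0 <- coact a0)
   (rep_act X (a1 * h1) x ⊗ zeta ((b1 * h2) ⊗ rep_act M b0 m))).
  by apply: eq_tlift => a1 a0; rewrite exchange_tlift.
rewrite exchange_tlift; apply: eq_tlift => h1 h2.
rewrite tens_repE; apply: eq_tlift => a1 a0.
rewrite -hz hrepE rep_actMx.
by rewrite (linear_tlift (f := fun u : tensor H M =>
   rep_act X a1 (rep_act X h1 x) ⊗ zeta u)) //; lin.
Qed.

Lemma is_hom_comp (A : falgType k) (P Q R : rep A) (f : 'Hom(Q, R))
    (g : 'Hom(P, Q)) :
  is_hom f -> is_hom g -> is_hom (f \o g)%VF.
Proof. by move=> hf hg a x; rewrite !comp_lfunE hg hf. Qed.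

(** Both pairings become traces by [pairing_higman].  The trace over [X ⊗ M]
    splits as a value of [q] times a trace over [M]; the factors [gL^-1] and
    [c] combine to [gH^-1], and [tsum_int_cancel] applies. *)
Lemma serre_twist_eq X M N (p : ldual (ldual X)) (q : ldual X)
    (zeta : 'Hom(hrep N, serre M)) (eta : 'Hom(hrep M, N)) :
  is_hom zeta -> is_hom eta ->
  serre_pairing (serre_twist X M \o ihom_a p zeta)%VF
    (ihom_b eta q \o tmap \1 (tmap (bidual X) \1))%VF =
  (p : 'Hom(dual_space X, k^o)) q * serre_pairing zeta eta.
Proof.
move=> hz he; have [x ->] := bidual_surj p.
have [d [t [t' tt']]] := hrep_dual_family exL M.
have := hom_higman Fr tt' he.
set f := linfun _ => ->.
rewrite ihom_b_higman (pairing_higman gg coint exL); last first.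
  apply: is_hom_comp; last exact: ihom_a_hom.
  exact: serre_twist_hom.
rewrite (pairing_higman gg coint exL) // bidualE.
pose Psi u v : k^o := lftrace (fun m : M => zeta ((gL^-1 * u) ⊗ f (v ⊗ m)) : M).
have Psi1 v : linear (fun u => Psi u v) by apply: lin_lftrace => m; lin.
have Psi2 u : linear (Psi u) by apply: lin_lftrace => m; lin.
have -> : lftrace (fun m => pairing_op gL zeta f (Λ ⊗ m)) =
    \tsum_(a, b <- comul Λ) Psi a b.
  rewrite -lftrace_tlift; apply: eq_lftrace => m.
  exact: pairing_opE.
pose q' : 'Hom(X, k^o) := q.
pose G u v w : k^o := ⟨q', rep_act X w x⟩ *: Psi u v.
transitivity (\tsum_(a, b <- comul Λ) \tsum_(a1, a2 <- comul a)
   \tsum_(b1, b2 <- comul b) G a2 b1 (S b2 * (gH^-1 * S (S a1)))); last first.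
  rewrite (tsum_int_cancel I (G := G)); try by rewrite /G; lin.
  rewrite /G -tlift_scale rep_act1x; congr (_ * _).
transitivity (lftrace (fun z : tensor X M => \tsum_(a, b <- comul Λ)
  \tsum_(a1, a2 <- comul a) \tsum_(b1, b2 <- comul b) \tsum_(y, m <- z)
   (⟨q', rep_act X (S b2) y⟩ *: (rep_act X (gH^-1 * S (S a1)) x ⊗
     (zeta ((gL^-1 * a2) ⊗ f (b1 ⊗ m)) : M))))).
  apply: eq_lftrace; apply: tens_ext.
  - by apply: lin_comp; [exact: lin_pairing_op|lin].
  - by lin.
  move=> y m; rewrite pairing_opE; apply: eq_tlift => a b.
  rewrite comp_lfunE lin_ihom_bE.
  rewrite (linear_tlift (f := fun u : N => serre_twist X M
    (ihom_a (bidual X x : ldual (ldual X)) zeta ((gL^-1 * a) ⊗ u))));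
      last by lin.
  rewrite exchange_tlift; apply: eq_tlift => b1 b2.
  rewrite ihom_aE tsum_comulM; [|lin..].
  rewrite (grouplike_comul (grouplikeV gg)); [|lin..].
  rewrite (linear_tlift (f := serre_twist X M)); last by lin.
  apply: eq_tlift => a1 a2; rewrite tlift_tens; [|by lin..].
  rewrite bidual_act serre_twistE -rep_actMx.
  have -> : c * S (S (gL^-1 * a1)) = gH^-1 * S (S a1).
    rewrite !antipodeM (grouplike_antipode (grouplikeV gg)) invrK.
    by rewrite (grouplike_antipode gg) -mulrA mulVKr // (grouplike_unit gg).
  by rewrite (fun_linearZ (f := fun u : N => rep_act X (gH^-1 * S (S a1)) x ⊗
    (zeta ((gL^-1 * a2) ⊗ u) : M))) //; lin.
rewrite lftrace_tlift; apply: (@eq_tlift _ _ _ k^o) => a b.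
rewrite lftrace_tlift; apply: (@eq_tlift _ _ _ k^o) => a1 a2.
rewrite lftrace_tlift; apply: (@eq_tlift _ _ _ k^o) => b1 b2.
rewrite (lftrace_tens (phi := fun y => q' (rep_act X (S b2) y))
  _ (w := fun m : M => (zeta ((gL^-1 * a2) ⊗ f (b1 ⊗ m)) : M))); [|by lin..].
by rewrite -rep_actMx.
Qed.

(** For a linear form [chi], the value [chi (xi (p ⊗ m))] is the trace of the
    rank-one map [z |-> chi z *: xi (p ⊗ m)].  This is the pairing of
    [xi \o ihom_a p zeta] with the average of a rank-one map [f], where [zeta]
    is the counit.  As [f] is a sum of maps in the image of [lin_ihom_b], the
    equation expresses that pairing without [xi]. *)
Lemma twisted_determined X M
    (xi xi' : 'Hom(ldual (ldual X) ▷ serre M, serre (X ▷ M))) :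
    let good (xi : 'Hom(ldual (ldual X) ▷ serre M, serre (X ▷ M))) :=
      is_hom xi /\
      forall (p : ldual (ldual X)) (q : ldual X)
      (zeta : 'Hom(hrep (serre M), serre M)) (eta : 'Hom(hrep M, serre M)),
      is_hom zeta -> is_hom eta ->
      serre_pairing (xi \o ihom_a p zeta)%VF
        (ihom_b eta q \o tmap \1 (tmap (bidual X) \1))%VF =
      (p : 'Hom(dual_space X, k^o)) q * serre_pairing zeta eta in
  good xi -> good xi' -> xi = xi'.
Proof.
move=> good; suff formula chi p m : exists d : k, forall xi, good xi ->
    (chi : 'Hom(tensor X M, k^o)) (xi (p ⊗ m)) = d.
  move=> gxi gxi'; apply/lfunP; apply: tens_ext; [by lin|by lin|move=> p m].
  apply: dual_separates => chi; have [d dE] := formula chi p m.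
  by rewrite !dE.
(* With this [w], [tsum_int_snd] turns [λ(Λ_2 S w) gL^-1 Λ_1] into [1]. *)
pose w := gH^-1 * gL.
pose f : 'Hom(hrep (X ▷ M), serre M) := linfun (fun t : tensor H (tensor X M) =>
  \tsum_(h, z <- t) ⟨λ, h * S w⟩ *: (⟨chi, z⟩ *: m)).
have fE h z : f (h ⊗ z) = ⟨λ, h * S w⟩ *: (⟨chi, z⟩ *: m).
  by rewrite lin_lfunE ?tlift_tens //; lin.
pose fj (j : 'I_(\dim {:X})) : 'Hom(hrep M, serre M) :=
  linfun (fun t : tensor H M =>
  \tsum_(h, u <- t) \tsum_(h1, h2 <- comul h)
    f (h1 ⊗ (rep_act X h2 (tbase X)`_j ⊗ u))).
have fjE j h u : fj j (h ⊗ u) =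
    \tsum_(h1, h2 <- comul h) f (h1 ⊗ (rep_act X h2 (tbase X)`_j ⊗ u)).
  by rewrite lin_lfunE ?tlift_tens //; lin.
pose x' j : 'Hom(X, k^o) := linfun (coord (tbase X) j : X -> k^o).
have fsum : f = \sum_j lin_ihom_b (fj j) (x' j).
  apply/lfunP; apply: tens_ext3; [by lin|by lin|move=> h y u].
  rewrite sum_lfunE; under eq_bigr do rewrite lin_ihom_bE.
  rewrite -tlift_sum.
  transitivity (\tsum_(h1, r <- comul h) \tsum_(h2, h3 <- comul r)
     f (h1 ⊗ (rep_act X (h2 * S h3) y ⊗ u))).
    rewrite (tsum_KSr (F := fun h1 v => f (h1 ⊗ (rep_act X v y ⊗ u))));
      [|lin..].
    by rewrite rep_act1x.
  rewrite -(tsum_comulA (T := fun h1 h2 h3 =>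
    f (h1 ⊗ (rep_act X (h2 * S h3) y ⊗ u))));
    [|lin..].
  apply: eq_tlift => h1 h2.
  under [RHS]eq_bigr do rewrite fjE tlift_scale.
  rewrite -tlift_sum; apply: eq_tlift => a b; rewrite rep_actMx.
  by rewrite (tbase_expand (F := fun v => f (a ⊗ (rep_act X b v ⊗ u)))) //; lin.
pose zeta : 'Hom(hrep (serre M), serre M) := linfun (fun t : tensor H M =>
  \tsum_(h, u <- t) ⟨counit, h⟩ *: u).
have zetaE h u : zeta (h ⊗ u) = ⟨counit, h⟩ *: u.
  by rewrite lin_lfunE ?tlift_tens //; lin.
have hz : is_hom zeta.
  move=> a; apply: tens_ext; [by lin|by lin|move=> h u].
  rewrite hrepE (linear_tlift (f := zeta)); last by lin.
  rewrite zetaE fun_linearZ; last by lin.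
  rewrite -[a in RHS](coact_counit a).
  rewrite (linear_tlift (f := fun a => ⟨counit, h⟩ *: rep_act (serre M) a u));
    last by lin.
  apply: eq_tlift => a1 a0; rewrite zetaE counitM.
  rewrite (fun_linearZ (f := fun a => ⟨counit, h⟩ *: rep_act (serre M) a u));
    last by lin.
  by rewrite scalerA.
(* The sum over [j] is the expansion of [f] in [fsum], evaluated term by term
   through the equation. *)
exists (\sum_j (p : 'Hom(dual_space X, k^o)) (x' j) *
  serre_pairing zeta (higman Fr (fj j))).
move=> {xi xi'} xi [hxi eqxi].
have hc : is_hom (xi \o ihom_a p zeta)%VF.
  by apply: is_hom_comp => //; exact: ihom_a_hom.
transitivity (lftrace (fun z : tensor X M =>
    ⟨chi, z⟩ *: (xi (p ⊗ m) : tensor X M))).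
  rewrite (lftrace_rank (J := unit) (psi := fun _ z => chi z)
    (v := fun=> xi (p ⊗ m))).
  - by rewrite big_const card_unit /= addr0.
  - by move=> _; lin.
  by move=> z; rewrite big_const card_unit /= addr0.
transitivity (lftrace (fun z : tensor X M =>
    pairing_op gL (xi \o ihom_a p zeta)%VF f (Λ ⊗ z))).
  apply: (@eq_lftrace k (tensor X M)) => z; rewrite pairing_opE.
  pose Fa a : tensor X M := ⟨chi, z⟩ *: (xi (ihom_a p zeta
    ((gL^-1 * a) ⊗ m)) : tensor X M).
  transitivity (\tsum_(a, b <- comul Λ) (⟨λ, b * S w⟩ *: Fa a)); last first.
    apply: eq_tlift => a b; rewrite comp_lfunE fE /Fa.
    by rewrite !(fun_linearZ (f := fun u : M =>
      xi (ihom_a p zeta ((gL^-1 * a) ⊗ u)) : tensor X M)) //; lin.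
  rewrite (tsum_int_snd I (F := Fa)); last by rewrite /Fa; lin.
  rewrite /Fa /w mulVKr; last exact/grouplike_unit/int_g_grouplike.
  rewrite mulVr; last exact: (grouplike_unit gg).
  rewrite ihom_aE comul1 tlift_tens; [|by lin..].
  by rewrite rep_act1x zetaE counit1 scale1r.
transitivity (\sum_j lftrace (fun z : tensor X M =>
    pairing_op gL (xi \o ihom_a p zeta)%VF (lin_ihom_b (fj j) (x' j)) (Λ ⊗ z))).
  rewrite -lftrace_sum; apply: (@eq_lftrace k (tensor X M)) => z.
  under [RHS]eq_bigr do rewrite pairing_opE.
  rewrite -tlift_sum pairing_opE fsum; apply: eq_tlift => a b.
  rewrite sum_lfunE.
  by rewrite (fun_linear_sum (f := fun u : M =>
    (xi \o ihom_a p zeta)%VF ((gL^-1 * a) ⊗ u))) //; lin.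
apply: eq_bigr => j _.
have E := pairing_higman gg coint exL (lin_ihom_b (fj j) (x' j)) hc.
rewrite -ihom_b_higman eqxi // in E; last exact: higman_hom.
Qed.

Lemma serre_twist_structure : is_twisted_structure I Fr serre_twist.
Proof.
split.
- exact: serre_twist_hom.
- exact: serre_twist_bij.
- exact: serre_twist_natural.
- exact: serre_twist_eq.
Qed.

Lemma twisted_structure_unique xi X M :
  is_twisted_structure I Fr xi -> xi X M = serre_twist X M.
Proof.
move=> hxi; apply: twisted_determined.
  split; first exact: twisted_hom hxi X M.
  by move=> p q zeta eta; apply: (twisted_eq hxi).
by split=> [|p q zeta eta]; [exact: serre_twist_hom|exact: serre_twist_eq].
Qed.

Lemma frakT_cointegral : frakT I Fr = (gL^-1 * gH) ⊗ 1.
Proof.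
have SSSE : S (S (S gL)) = gL^-1.
  by rewrite !(grouplike_antipode gg, grouplike_antipode (grouplikeV gg)) invrK
     (grouplike_antipode gg).
pose R (a : L) : L := \tsum_(a1, a0 <- coact a) ⟨α, a1⟩ *: a0.
have lR : linear R by rewrite /R; lin.
transitivity (\sum_(i < \dim {:L}) ⟨lam, 1 * (frob_b Fr)`_i⟩ *:
   ((gL^-1 * gH) ⊗ R ((frob_a Fr)`_i))).
  apply: eq_bigr => i _.
  rewrite (tsum_cointegral coint (F := fun x => S (S (S x)) * gH)); last by lin.
  by rewrite SSSE mul1r tensZl.
transitivity ((gL^-1 * gH) ⊗ R 1).
  rewrite [X in R X](frob_a_expand Fr) (fun_linear_sum (f := fun x =>
    _ ⊗ R x)); last by lin.
  by apply: eq_bigr => i _; rewrite (fun_linearZ (f := fun x => _ ⊗ R x)) //;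
    lin.
by rewrite /R coact1 tlift_tens ?int_alpha1 ?scale1r //; lin.
Qed.

End Twisted.

Theorem theorem4p22 (k : fieldType) (H : hopfAlg k) (L : comodAlg H)
    (I : integralData H) (F : frobSystem L) (gL : H) :
  exact_comodAlg L -> grouplike gL -> is_cointegral gL (frob_form F) ->
  [/\ frakT I F = (gL^-1 * int_g I) ⊗ 1,
      exists xi, is_twisted_structure I F xi &
      forall xi, is_twisted_structure I F xi ->
        forall (X : rep H) (M : rep L) (x : X) (m : M),
        ((xi X M)^-1)%VF (x ⊗ m) =
          bidual X (rep_act X (gL^-1 * int_g I) x) ⊗ m].
Proof.
move=> exL gg coint; split; first exact: frakT_cointegral.
  by exists (@serre_twist k H L I F gL); exact: serre_twist_structure.
move=> xi hxi X M x m; rewrite (twisted_structure_unique gg coint exL X M hxi).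
have inj : lker (serre_twist I F gL X M) == 0%VS.
  by apply/lker0P; apply: bij_inj; exact: serre_twist_bij.
have uL := grouplike_unit gg; have uH := grouplike_unit (int_g_grouplike I).
rewrite -[RHS](lker0_lfunK inj) serre_twistE -rep_actMx.
by rewrite mulrA mulrK ?mulVr ?rep_act1x.
Qed.
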